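(* Let \(\mu\) be an infinite cardinal and \(\lambda=\mu^+\). Suppose there is an almost disjoint \(\lambda\)-sequence \(\mathcal{B}=\langle B_\alpha:\alpha<\lambda\rangle\) of subsets of \(\mu\) which is definable on \(L_\lambda\), and suppose that for every club subset \(C\) of \(\lambda\) there is a subset \(X\) of \(\mu\) such that for all \(\alpha<\lambda\): \(\alpha\in C\iff\sup(B_\alpha\setminus X)<\mu\). Then there is a sentence \(\varphi\in L_{\lambda\lambda}\) such that for all \(A\subseteq\lambda\): \(\langle\lambda,<,A\rangle\models\varphi\) if and only if \(A\) is stationary in \(\lambda\).
   Context: Sets \(A,B\subseteq\mu\) are almost disjoint if \(\sup(A\cap B)<\mu\). An almost disjoint \(\lambda\)-sequence of subsets of \(\mu\) is a sequence \(\langle B_\alpha:\alpha<\lambda\rangle\) of subsets of \(\mu\) with \(|B_\alpha|=\mu\) for all \(\alpha\) and \(B_\alpha,B_\beta\) almost disjoint for \(\alpha\ne\beta\). It is definable on \(L_\lambda\) if there is a sequence of ordinals \(\langle\delta_\alpha:\alpha<\lambda\rangle\) with \(\limsup_{\alpha<\lambda}\delta_\alpha=\lambda\) such that the predicates ''\(x\in B_y\wedge y<\delta_\alpha\)'' and ''\(x=\delta_y\wedge x<\alpha\wedge y<\alpha\)'' are first-order definable, uniformly, on every \(\langle L_\alpha,\in\rangle\), \(\alpha<\lambda\); in particular there is a first-order formula \(\varphi_0(x,y)\) of set theory with \(x\in B_y\wedge y<\delta_\alpha\iff\langle L_\alpha,\in\rangle\models\varphi_0(x,y)\) for all \(x,y<\alpha<\lambda\)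 (\(L_\alpha\) the constructible hierarchy). \(L_{\lambda\lambda}\) is the infinitary logic with conjunctions/disjunctions of fewer than \(\lambda\) formulas and quantification over blocks of fewer than \(\lambda\) variables; \(<\) is the ordinal order on \(\lambda\). *)

(* Defs.v *)
From mathcomp Require Import all_boot.
From mathcomp Require Import boolp classical_sets functions cardinality.

Set Implicit Arguments.
Unset Strict Implicit.
Unset Printing Implicit Defensive.

Local Open Scope classical_set_scope.
Local Open Scope card_scope.

(* The universe of sets: Aczel's well-founded trees modulo bisimulation.  A
   set is the bisimulation class of a tree, so that Leibniz equality of sets is
   extensional equality (lemma sets_ext).  By family_set any family of sets
   indexed by a small type is the range of a set; with the classical axioms of
   boolp this makes (V, ∈) a model of ZFC.  Every subclass [S : set V] of a set
   is itself a set, hence subsets of a set are taken in the type [set V]. *)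

Inductive tree : Type := Node (I : Type) of (I -> tree).

Fixpoint bisim (s t : tree) : Prop :=
  let: Node J f := s in let: Node K g := t in
  (forall i, exists j, bisim (f i) (g j)) /\
  (forall j, exists i, bisim (f i) (g j)).

Definition child (s t : tree) : Prop :=
  let: Node J g := t in exists j, bisim s (g j).

Definition V : Type := {S : set tree | exists t, S = [set s | bisim s t]}.

Definition memV (x y : V) : Prop :=
  exists s t, [/\ sval x s, sval y t & child s t].

Notation "x ∈ y" := (memV x y) (at level 70, no associativity).

Definition elts (x : V) : set V := [set y | y ∈ x].

Lemma bisim_refl t : bisim t t.
Proof. by elim: t => I f IH /=; split=> i; exists i. Qed.

Lemma bisim_sym s t : bisim s t -> bisim t s.
Proof.
elim: s t => I f IH [J g] /= [h1 h2]; split=> i.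
  by have [j /IH] := h2 i; exists j.
by have [j /IH] := h1 i; exists j.
Qed.

Lemma bisim_trans s t u : bisim s t -> bisim t u -> bisim s u.
Proof.
elim: s t u => I f IH [J g] [K h] /= [a1 a2] [b1 b2]; split=> i.
  by have [j /IH p] := a1 i; have [k /p] := b1 j; exists k.
by have [j q] := b2 i; have [k /IH p] := a2 j; exists k; apply: p q.
Qed.

Lemma child_bisim s s' t t' :
  bisim s s' -> bisim t t' -> child s t -> child s' t'.
Proof.
case: t t' => [J g] [J' g'] /= ss' [h1 h2] [j sj].
have [j' jj'] := h1 j; exists j'.
by apply: bisim_trans jj'; apply: bisim_trans sj; apply: bisim_sym.
Qed.

Definition class (t : tree) : V :=
  exist (fun S => exists t, S = [set s | bisim s t]) [set s | bisim s t]
        (ex_intro _ t erefl).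

Lemma classP (x : V) : exists t, x = class t.
Proof. by case: x => S [t St]; exists t; apply: eq_exist. Qed.

Lemma class_eq s t : bisim s t -> class s = class t.
Proof.
move=> st; apply: eq_exist; apply/seteqP; split=> u /= us.
  exact: bisim_trans st.
by apply: bisim_trans us _; apply: bisim_sym.
Qed.

Lemma memV_class s t : (class s ∈ class t) <-> child s t.
Proof.
split=> [[s' [t' [/= ss' tt' h]]]|h]; first exact: child_bisim h.
by exists s, t; split=> //; apply: bisim_refl.
Qed.

Lemma sets_ext (x y : V) : (forall z, z ∈ x <-> z ∈ y) -> x = y.
Proof.
have [s ->] := classP x; have [t ->] := classP y.
case: s t => [I f] [J g] xy; apply: class_eq; split=> i.
  have /xy/memV_class[j ?] : class (f i) ∈ class (Node f).
    by apply/memV_class; exists i; apply: bisim_refl.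
  by exists j.
have /xy/memV_class[j ?] : class (g i) ∈ class (Node g).
  by apply/memV_class; exists i; apply: bisim_refl.
by exists j; apply: bisim_sym.
Qed.

Lemma memV_wf : well_founded memV.
Proof.
move=> x; have [t ->] := classP x; elim: t => I f IH.
constructor=> y; have [s ->] := classP y => /memV_class[i si].
by rewrite (class_eq si).
Qed.

Lemma family_set (J : Type) (f : J -> V) :
  exists x, forall z, z ∈ x <-> exists j, z = f j.
Proof.
have [g fE] := choice (fun j => classP (f j)).
exists (class (Node g)) => z; have [s ->] := classP z.
split=> [/memV_class[j sj]|[j ->]].
  by exists j; rewrite fE; apply: class_eq.
by rewrite fE; apply/memV_class; exists j; apply: bisim_refl.
Qed.

(* Ordinals are von Neumann ordinals, ordered by membership. *)

Definition transV (x : V) : Prop := forall y, y ∈ x -> elts y `<=` elts x.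

Definition ordinal_set (a : V) : Prop :=
  transV a /\ forall b, b ∈ a -> transV b.

Definition leV (a b : V) : Prop := a ∈ b \/ a = b.

Definition limit_ordinal (a : V) : Prop :=
  [/\ ordinal_set a, elts a !=set0 & forall b, b ∈ a -> exists2 c, c ∈ a & b ∈ c].

Definition is_sup (S : set V) (s : V) : Prop :=
  [/\ ordinal_set s, forall x, S x -> leV x s &
      forall t, ordinal_set t -> (forall x, S x -> leV x t) -> leV s t].

Definition sup_lt (S : set V) (m : V) : Prop := exists2 s, is_sup S s & s ∈ m.

(* [l] is the limsup of [d a] for [a < la]: the least among the suprema of the
   tails [b <= a < la]. *)
Definition is_limsup (la : V) (d : V -> V) (l : V) : Prop :=
  let tail b := d @` [set a | a ∈ la /\ leV b a] in
  (exists2 b, b ∈ la & is_sup (tail b) l) /\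
  (forall b s, b ∈ la -> is_sup (tail b) s -> leV l s).

Definition cardinal (k : V) : Prop :=
  ordinal_set k /\ forall a, a ∈ k -> ~ (elts a #= elts k).

Definition infinite_cardinal (k : V) : Prop :=
  cardinal k /\ infinite_set (elts k).

Definition successor_cardinal (mu la : V) : Prop :=
  [/\ cardinal la, mu ∈ la & forall k, cardinal k -> mu ∈ k -> leV la k].

Definition unbounded_in (S : set V) (a : V) : Prop :=
  forall b, b ∈ a -> exists c, [/\ S c, c ∈ a & b ∈ c].

Definition club (la : V) (C : set V) : Prop :=
  [/\ C `<=` elts la, unbounded_in C la &
      forall g, g ∈ la -> limit_ordinal g -> unbounded_in C g -> C g].

Definition stationary (la : V) (A : set V) : Prop :=
  forall C, club la C -> A `&` C !=set0.

(* First-order formulas of the language {∈, =} with free variables among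
   0, ..., n-1; in [FEx f] the bound variable is variable 0 of [f] and the
   other variables are shifted by one. *)
Inductive fo : nat -> Type :=
| FEq n of 'I_n & 'I_n : fo n
| FIn n of 'I_n & 'I_n : fo n
| FNot n of fo n : fo n
| FAnd n of fo n & fo n : fo n
| FEx n of fo n.+1 : fo n.

(* Satisfaction in the structure <M, ∈>. *)
Fixpoint fsat (M : set V) n (f : fo n) : n.-tuple V -> Prop :=
  match f in fo n return n.-tuple V -> Prop with
  | FEq _ i j => fun e => tnth e i = tnth e j
  | FIn _ i j => fun e => tnth e i ∈ tnth e j
  | FNot _ g => fun e => ~ fsat M g e
  | FAnd _ g h => fun e => fsat M g e /\ fsat M h e
  | FEx _ g => fun e => exists2 x, M x & fsat M g [tuple of x :: e]
  end.

(* The class of subsets of M first-order definable over <M, ∈> with parameters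
   in M. *)
Definition Def (M : set V) : set V :=
  [set x | exists n (f : fo n.+1) (p : n.-tuple V),
    (forall i, M (tnth p i)) /\
    elts x = [set y | M y /\ fsat M f [tuple of y :: p]]].

(* The constructible hierarchy, by the recursion L_a = \bigcup_(b < a) Def L_b;
   see constructible0, constructible_succ and constructible_limit for the usual
   clauses. *)
Definition constructible : V -> set V :=
  Fix memV_wf (fun _ => set V)
    (fun a L => [set x | exists b (ba : b ∈ a), Def (L b ba) x]).

Lemma constructibleE a :
  constructible a = [set x | exists2 b, b ∈ a & Def (constructible b) x].
Proof.
rewrite /constructible Fix_eq => [|b f g fg]; last first.
  by congr mkset; apply/funext=> x; apply: eq_exists => c;
    apply: eq_exists => cb; rewrite fg.
apply/seteqP; split=> x /=; first by move=> [b [ba h]]; exists b.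
by move=> [b ba h]; exists b, ba.
Qed.

Lemma constructible_mono a b :
  elts b `<=` elts a -> constructible b `<=` constructible a.
Proof.
move=> ba x; rewrite (constructibleE b) (constructibleE a) => -[c cb h].
by exists c => //; apply: ba.
Qed.

Lemma constructible_trans a x y :
  transV a -> constructible a x -> y ∈ x -> constructible a y.
Proof.
move=> ta; rewrite {1}constructibleE => -[b ba [n [f [p [_ xE]]]]] yx.
apply: (constructible_mono (ta b ba)).
by have : elts x y by []; rewrite xE => -[].
Qed.

Lemma constructible_Def a :
  transV a -> constructible a `<=` Def (constructible a).
Proof.
move=> ta x ax; exists 1, (FIn ord0 (lift ord0 ord0)), [tuple of [:: x]].
split=> [i|]; first by rewrite (tnth_nth x) ord1.
apply/seteqP; split=> y /=; rewrite !(tnth_nth x) /=; last by case.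
by move=> yx; split=> //; apply: constructible_trans ax yx.
Qed.

Lemma constructible0 a : elts a = set0 -> constructible a = set0.
Proof.
move=> a0; rewrite constructibleE; apply/seteqP; split=> x // -[b ba _].
by have : elts a b by []; rewrite a0.
Qed.

Lemma constructible_succ a s :
  transV a -> elts s = elts a `|` [set a] ->
  constructible s = Def (constructible a).
Proof.
move=> ta sE; rewrite constructibleE; apply/seteqP; split=> x /=.
  move=> [b bs h]; have : elts s b by [].
  rewrite sE => -[ba|<- //]; apply: constructible_Def => //.
  by rewrite constructibleE; exists b.
by move=> h; exists a => //; have : elts s a by rewrite sE; right.
Qed.

Lemma constructible_limit a : limit_ordinal a ->
  constructible a = \bigcup_(b in elts a) constructible b.
Proof.
move=> [[ta _] _ la]; apply/seteqP; split=> x.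
  rewrite {1}constructibleE => -[b /la[c ca bc] h].
  by exists c => //; rewrite constructibleE; exists b.
by move=> [b ba h]; apply: constructible_mono h; apply: ta.
Qed.

(* Sequences indexed by the ordinals below [la] are functions on V of which
   only the values at members of [la] are considered. *)

Definition almost_disjoint (mu : V) (A B : set V) : Prop :=
  sup_lt (A `&` B) mu.

Definition almost_disjoint_sequence (mu la : V) (B : V -> set V) : Prop :=
  (forall a, a ∈ la -> B a `<=` elts mu /\ B a #= elts mu) /\
  (forall a b, a ∈ la -> b ∈ la -> a <> b -> almost_disjoint mu (B a) (B b)).

Definition definable_on_L (la : V) (B : V -> set V) : Prop :=
  exists delta : V -> V,
    [/\ forall a, a ∈ la -> ordinal_set (delta a),
        is_limsup la delta la,
        exists phi0 : fo 2, forall a x y, a ∈ la -> x ∈ a -> y ∈ a ->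
          (B y x /\ y ∈ delta a) <-> fsat (constructible a) phi0 [tuple x; y] &
        exists phi1 : fo 2, forall a x y, a ∈ la -> x ∈ a -> y ∈ a ->
          (x = delta y /\ x ∈ a /\ y ∈ a) <->
          fsat (constructible a) phi1 [tuple x; y]].

Definition card_lt T U (A : set T) (B : set U) : Prop :=
  A #<= B /\ ~ (B #<= A).

(* Formulas of the infinitary logic L_{la,la} in the vocabulary {<, P} with
   equality, P unary, and free variables in the type X.  A quantifier binding
   the block of variables Y takes a formula with free variables in X + Y. *)
Inductive Linf (la : V) (X : Type) : Type :=
| LLt of X & X
| LEq of X & X
| LP of X
| LNot of Linf la X
| LAnd (I : Type) of card_lt [set: I] (elts la) & (I -> Linf la X)
| LOr (I : Type) of card_lt [set: I] (elts la) & (I -> Linf la X)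
| LAll (Y : Type) of card_lt [set: Y] (elts la) & Linf la (X + Y)%type
| LEx (Y : Type) of card_lt [set: Y] (elts la) & Linf la (X + Y)%type.

Definition Lsentence (la : V) : Type := Linf la void.

Definition join_env X Y D (e : X -> D) (e' : Y -> D) (v : X + Y) : D :=
  match v with inl x => e x | inr y => e' y end.

(* Satisfaction in the structure <D, lt, P>. *)
Fixpoint Lsat (D : Type) (lt : D -> D -> Prop) (P : D -> Prop) (la : V)
    (X : Type) (f : Linf la X) (e : X -> D) : Prop :=
  match f with
  | LLt x y => lt (e x) (e y)
  | LEq x y => e x = e y
  | LP x => P (e x)
  | LNot g => ~ Lsat lt P g e
  | LAnd _ _ g => forall i, Lsat lt P (g i) e
  | LOr _ _ g => exists i, Lsat lt P (g i) e
  | LAll Y _ g => forall e' : Y -> D, Lsat lt P g (join_env e e')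
  | LEx Y _ g => exists e' : Y -> D, Lsat lt P g (join_env e e')
  end.

(* <la, <, A> |= phi *)
Definition ordinal_models (la : V) (A : set V) (phi : Lsentence la) : Prop :=
  Lsat (D := {a : V | a ∈ la}) (fun a b => sval a ∈ sval b)
       (fun a => A (sval a)) phi (of_void _).

(* Main.v *)
Require Import Defs.
From mathcomp Require Import all_boot.
From mathcomp Require Import boolp classical_sets functions cardinality.

(* By the coding hypothesis, [A] is stationary iff it meets every club of the
   form [C_X = {a < la | sup (B_a \ X) < mu}] with [X] a subset of [mu], and
   subsets of [mu] are coded by blocks of [mu] variables.  It remains to define
   [x ∈ B_y] in the infinitary logic.  Since the limsup of the [delta_a] is [la],
   [x ∈ B_y] holds iff [L_a |= phi0(x, y)] for some [a < la] with [x, y < a].  As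
   [L_a] has size at most [mu], it is isomorphic to a structure on [mu], coded by
   variables for its membership relation, for the rank of each point and for the
   ordinal that a point represents.  That the structure is isomorphic to [L_a] is
   expressible: it is extensional, every point of rank [b] is definable over the
   points of rank below [b], and every subset definable over the points of rank
   below [b < a] is given by a point of rank at most [b].  Only countably many
   formulas and [mu] many tuples of parameters are involved. *)

Set Implicit Arguments.
Unset Strict Implicit.
Unset Printing Implicit Defensive.

Local Open Scope classical_set_scope.
Local Open Scope card_scope.

(** * Cardinal comparison through injections on whole types *)

Lemma card_le_inj T U (A : set T) (B : set U) (f : T -> U) :
  (forall x, A x -> B (f x)) ->
  (forall x y, A x -> A y -> f x = f y -> x = y) -> A #<= B.
Proof.
move=> fAB finj; apply: card_le_trans (subset_card_le (A := f @` A) _).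
  suff /card_eqPle[_] : f @` A #= A by [].
  by apply: inj_card_eq => x y; rewrite !inE; apply: finj.
by move=> _ [x Ax <-]; apply: fAB.
Qed.

(** Converse of [card_le_inj]: the injection between subtypes is extended to all of [T], with [u0]
    as default outside [A]. *)
Lemma card_le_exinj T U (u0 : U) (A : set T) (B : set U) : A #<= B ->
  exists f : T -> U, (forall x, A x -> B (f x)) /\
    (forall x y, A x -> A y -> f x = f y -> x = y).
Proof.
move=> /card_leP[f].
have fP (x : T) (Ax : A x) : x \in A by rewrite inE.
exists (fun x => if pselect (A x) is left Ax then val (f (SigSub (fP x Ax))) else u0).
split=> [x Ax|x y Ax Ay].
  by case: pselect => // Ax'; have := valP (f (SigSub (fP x Ax'))); rewrite inE.
case: pselect => // Ax'; case: pselect => // Ay' /val_inj e.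
have := @inj _ _ _ f (SigSub (fP x Ax')) (SigSub (fP y Ay')).
by rewrite !inE => /(_ I I e) [].
Qed.

(** * Small classes and collapses *)

(* The universe of [J] is that of the branching types of [tree], so that
   [small] excludes, for instance, the class of all sets. *)
Definition small T (S : set T) : Prop :=
  exists (J : Type) (g : J -> T), S `<=` range g.

(** The empty set is a default for classes that are not sets. *)
Definition toV (S : set V) : V :=
  if pselect (exists x, elts x = S) is left h then sval (cid h)
  else class (Node (of_void tree)).

Lemma toVE (S : set V) : small S -> elts (toV S) = S.
Proof.
move=> [J [g gS]]; rewrite /toV; case: pselect => [h|[]]; first by case: (cid h).
have [x xE] := family_set (fun j : {j | S (g j)} => g (sval j)).
exists x; apply/seteqP; split=> y; first by move=> /xE[[j Sj] ->].
by move=> Sy; apply/xE; have [j _ jy] := gS y Sy; subst y; exists (exist _ j Sy).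
Qed.

Lemma small_elts x : small (elts x).
Proof.
have [[I f] ->] := classP x; exists I, (fun i => class (f i)) => y.
have [s ->] := classP y => /memV_class[i si]; exists i => //.
exact/esym/class_eq.
Qed.

Lemma small_sub T (A B : set T) : A `<=` B -> small B -> small A.
Proof. by move=> AB [J [g gB]]; exists J, g => x /AB/gB. Qed.

Lemma small_image T U (f : T -> U) (A : set T) : small A -> small (f @` A).
Proof.
move=> [J [g gA]]; exists J, (f \o g) => _ [x /gA[j _ <-] <-].
by exists j.
Qed.

Lemma small_prod T U (A : set T) (B : set U) :
  small A -> small B -> small (A `*` B).
Proof.
move=> [J [g gA]] [K [h hB]]; exists (J * K)%type, (fun p => (g p.1, h p.2)).
by move=> [x y] [/= /gA[j _ <-] /hB[k _ <-]]; exists (j, k).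
Qed.

Lemma small_sig x : small [set: {y | y ∈ x}].
Proof.
have [J [g gx]] := small_elts x.
exists {j | g j ∈ x}, (fun j : {j | g j ∈ x} =>
  exist (fun y => y ∈ x) (g (sval j)) (svalP j)).
move=> [y yx] _; have [j _ jy] := gx y yx; subst y.
by exists (exist _ j yx) => //; apply: eq_exist.
Qed.

(** Mostowski collapse by recursion along [R]; smallness of the predecessors makes each image a set.
    Extensionality is not assumed, so injectivity of [pi] has to be shown at each use. *)
Lemma collapse_ex T (R : T -> T -> Prop) : well_founded R ->
  (forall t, small [set s | R s t]) ->
  exists pi : T -> V, forall t, elts (pi t) = pi @` [set s | R s t].
Proof.
move=> wfR smR.
pose F t (rec : forall s, R s t -> V) :=
  toV [set y | exists s (h : R s t), y = rec s h].
exists (Fix wfR _ F) => t; rewrite Fix_eq => [|s f g fg].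
  have E : [set y | exists s (_ : R s t), y = Fix wfR (fun=> V) F s] =
      Fix wfR (fun=> V) F @` [set s | R s t].
    by apply/seteqP; split=> [y [s [h ->]]|y [s h <-]]; exists s => //; exists h.
  by rewrite /F E toVE //; apply: small_image.
congr toV; apply/funext => y; apply/propext; split=> -[u [h ->]];
  by exists u, h.
Qed.

(** * Ordinals *)

Lemma memV_irr x : ~ (x ∈ x).
Proof. by elim: x / (memV_wf x) => x _ IH xx; apply: (IH x). Qed.

Lemma ordinal_mem a b : ordinal_set a -> b ∈ a -> ordinal_set b.
Proof.
move=> [ta ha] ba; split; first exact: ha.
by move=> c cb; apply: ha; apply: ta cb.
Qed.

Lemma ordinal_trans a b c : ordinal_set a -> b ∈ a -> c ∈ b -> c ∈ a.
Proof. by move=> [ta _] ba cb; apply: ta cb. Qed.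

Lemma elts_inj x y : elts x = elts y -> x = y.
Proof.
by move=> xy; apply: sets_ext => z; have : elts x z <-> elts y z by rewrite xy.
Qed.

(** Double induction. A point of [a] outside [b] is comparable with [b] by induction, which forces
    [b ∈ a]; symmetrically for a point of [b] outside [a]. If there is neither, extensionality gives
    equality. *)
Lemma ordinal_trich a b : ordinal_set a -> ordinal_set b ->
  [\/ a ∈ b, a = b | b ∈ a].
Proof.
elim: a / (memV_wf a) b => a _ IHa b oa; elim: b / (memV_wf b) => b _ IHb ob.
have [sab|/existsNP[c /not_implyP[ca ncb]]] := pselect (elts a `<=` elts b);
  last first.
  case: (IHa c ca b (ordinal_mem oa ca) ob) => // [<-|bc]; first by constructor 3.
  by constructor 3; apply: ordinal_trans bc.
have [sba|/existsNP[c /not_implyP[cb nca]]] := pselect (elts b `<=` elts a).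
  by constructor 2; apply: elts_inj; apply/seteqP.
case: (IHb c cb (ordinal_mem ob cb)) => // [ac|->]; last by constructor 1.
by constructor 1; apply: ordinal_trans ac.
Qed.

Lemma ordinal_leVN a b : ordinal_set a -> ordinal_set b -> ~ (a ∈ b) -> leV b a.
Proof. by move=> oa ob nab; case: (ordinal_trich oa ob) => // h; [right|left]. Qed.

Lemma leV_sub a b : ordinal_set b -> leV a b -> elts a `<=` elts b.
Proof. by move=> ob [ab c|-> //]; apply: ordinal_trans. Qed.

Lemma sub_leV a b : ordinal_set a -> ordinal_set b -> elts a `<=` elts b -> leV a b.
Proof.
move=> oa ob ab; apply: ordinal_leVN => // /ab; exact: memV_irr.
Qed.

Lemma leV_memV a b c : ordinal_set c -> leV a b -> b ∈ c -> a ∈ c.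
Proof. by move=> oc [ab bc|->//]; apply: ordinal_trans ab. Qed.

Lemma memV_leV a b c : ordinal_set c -> a ∈ b -> leV b c -> a ∈ c.
Proof. by move=> oc ab [bc|<-//]; apply: ordinal_trans ab. Qed.

(** The supremum is the union, which is indexed by a sum of the types that cover the members of
    [S]. *)
Lemma sup_ex (S : set V) : small S -> (forall x, S x -> ordinal_set x) ->
  exists s, is_sup S s.
Proof.
move=> [J [g gS]] oS.
have sm : small [set y | exists2 x, S x & y ∈ x].
  pose K j := projT1 (cid (small_elts (g j))).
  have kP j : exists h : K j -> V, elts (g j) `<=` range h :=
    projT2 (cid (small_elts (g j))).
  pose h j := projT1 (cid (kP j)).
  have hP j : elts (g j) `<=` range (h j) := projT2 (cid (kP j)).
  exists {j : J & K j}, (fun p => h (projT1 p) (projT2 p)).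
  move=> y [x /gS[j _ <-] /hP[k _ <-]].
  by exists (existT _ j k).
pose s := toV [set y | exists2 x, S x & y ∈ x].
have sP y : y ∈ s <-> exists2 x, S x & y ∈ x.
  by rewrite -[y ∈ s]/(elts s y) /s toVE.
have os : ordinal_set s.
  split=> [y /sP[x Sx yx] z zy|y /sP[x Sx yx]].
    by apply/sP; exists x => //; apply: ordinal_trans zy => //; apply: oS.
  by have [] := ordinal_mem (oS _ Sx) yx.
exists s; split=> // [x Sx|t ot tP].
  by apply: sub_leV => //; [exact: oS|move=> y yx; apply/sP; exists x].
apply: sub_leV => // y /sP[x Sx yx].
by apply: memV_leV yx _ => //; apply: tP.
Qed.

(** Replaces a supremum by a bound, the form that the infinitary formula expresses. *)
Lemma sup_lt_bounded (m : V) (S : set V) : ordinal_set m -> S `<=` elts m ->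
  sup_lt S m <-> exists2 x, x ∈ m & forall y, S y -> leV y x.
Proof.
move=> om Sm; split=> [[s [_ sS _] sm]|[x xm xS]]; first by exists s.
have [|y /Sm|s sS] := @sup_ex S; first exact: small_sub (small_elts m).
  exact: ordinal_mem.
exists s => //; case: sS => os _ /(_ x (ordinal_mem om xm) xS) sx.
exact: leV_memV xm.
Qed.

(** * Cardinal arithmetic *)

Lemma card_le_prod T U T' U' (t0 : T') (u0 : U') (A : set T) (B : set U)
    (A' : set T') (B' : set U') :
  A #<= A' -> B #<= B' -> A `*` B #<= A' `*` B'.
Proof.
move=> /(card_le_exinj t0)[f [fA fi]] /(card_le_exinj u0)[g [gB gi]].
apply: (@card_le_inj _ _ _ _ (fun p => (f p.1, g p.2))) => [[x y] [/= Ax By]|].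
  by split; [exact: fA|exact: gB].
by move=> [x y] [x' y'] [/= Ax By] [/= Ax' By'] [/fi -> // /gi ->].
Qed.

Lemma infinite_card_setU1 T (S : set T) (x : T) :
  infinite_set S -> S `|` [set x] #<= S.
Proof.
move=> /infiniteP/(card_le_exinj x)[h [hS hinj]].
have [Sx|nSx] := pselect (S x).
  by apply: subset_card_le => y [//|->].
have hI m n : h m = h n -> m = n by apply: hinj.
have {}hS n : S (h n) by apply: hS.
(* Hilbert's hotel: [x] takes the place of [h 0], each [h n] moves to [h n.+1], and all other points
   stay. *)
pose f y := if pselect (y = x) is left _ then h 0 else
  if pselect (exists n, y = h n) is left e then h (projT1 (cid e)).+1 else y.
apply: (@card_le_inj _ _ _ _ f) => [y Sy|y z Sy Sz].
  rewrite /f; case: pselect => [//|yx]; case: pselect => // _.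
  by case: Sy => // /yx.
rewrite /f; case: (pselect (y = x)) => [->|yx];
  case: (pselect (z = x)) => [-> //|zx].
- case: pselect => [e /hI //|ne hz]; case: ne; exists 0; exact: esym.
- case: pselect => [e /hI //|ne hz]; case: ne; exists 0; exact: hz.
case: pselect => [e|ne]; case: pselect => [e'|ne'].
- by case: (cid e) => n yn; case: (cid e') => m zm /= /hI[nm]; rewrite yn zm nm.
- by move=> hz; case: ne'; exists (projT1 (cid e)).+1.
- by move=> hz; case: ne; exists (projT1 (cid e')).+1.
- by [].
Qed.

(** If [a] is not a cardinal, it is equinumerous with a smaller ordinal, to which the induction
    applies. *)
Lemma cardinality_ex a : ordinal_set a ->
  exists k, [/\ cardinal k, leV k a & elts k #= elts a].
Proof.
elim: a / (memV_wf a) => a _ IH oa.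
have [ca|nca] := pselect (cardinal a).
  by exists a; split=> //; right.
have [b ba ab] : exists2 b, b ∈ a & elts b #= elts a.
  apply: contrapT => h; apply: nca; split=> // b ba ab; apply: h.
  by exists b.
have [k [ck kb kbE]] := IH b ba (ordinal_mem oa ba).
exists k; split=> //; last exact: card_eq_trans ab.
by left; apply: leV_memV ba.
Qed.

Lemma cardinal_not_le k a : cardinal k -> a ∈ k -> ~ (elts k #<= elts a).
Proof.
move=> [ok ck] ak ka; apply: (ck a ak); apply/card_eqPle; split=> //.
by apply: subset_card_le; apply: leV_sub => //; left.
Qed.

Definition maxV (a b : V) : V := if pselect (a ∈ b) is left _ then b else a.

Lemma maxV_le a b : ordinal_set a -> ordinal_set b ->
  leV a (maxV a b) /\ leV b (maxV a b).
Proof.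
rewrite /maxV => oa ob; case: pselect => h; split; try by right.
  by left.
exact: ordinal_leVN.
Qed.

Lemma maxV_mem a b c : a ∈ c -> b ∈ c -> maxV a b ∈ c.
Proof. by rewrite /maxV; case: pselect. Qed.

(** Gödel's order on pairs of ordinals: by maximum, then lexicographically. *)
Definition goedel_lt (p q : V * V) : Prop :=
  let m := maxV p.1 p.2 in let n := maxV q.1 q.2 in
  m ∈ n \/ m = n /\ (p.1 ∈ q.1 \/ p.1 = q.1 /\ p.2 ∈ q.2).

Lemma goedel_wf : well_founded goedel_lt.
Proof.
suff H m a b : maxV a b = m -> Acc goedel_lt (a, b) by move=> [a b]; exact: H.
elim: m / (memV_wf m) a b => m _ IHm a; elim: a / (memV_wf a) => a _ IHa b.
elim: b / (memV_wf b) => b _ IHb abm; constructor=> -[c d].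
rewrite /goedel_lt /= abm => -[h|[e [h|[ca h]]]]; first exact: (IHm _ h).
  exact: IHa.
by rewrite ca in e *; apply: IHb.
Qed.

Lemma goedel_trans (mu : V) p q r : ordinal_set mu ->
  (elts mu `*` elts mu) r -> goedel_lt p q -> goedel_lt q r -> goedel_lt p r.
Proof.
case: p q r => [a b] [c d] [x y] omu [/= xmu ymu]; rewrite /goedel_lt /=.
have om := ordinal_mem omu (maxV_mem xmu ymu).
have ox := ordinal_mem omu xmu; have oy := ordinal_mem omu ymu.
move=> [h|[-> h]] [k|[<- k]]; try by left.
  by left; apply: ordinal_trans h.
right; split=> //; case: h k => [h|[-> h]] [k|[<- k]]; try by left.
  by left; apply: ordinal_trans h.
by right; split=> //; apply: ordinal_trans h.
Qed.

Lemma goedel_total (mu : V) p q : ordinal_set mu ->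
  (elts mu `*` elts mu) p -> (elts mu `*` elts mu) q ->
  [\/ goedel_lt p q, p = q | goedel_lt q p].
Proof.
case: p q => [a b] [c d] omu [/= amu bmu] [/= cmu dmu]; rewrite /goedel_lt /=.
have T x y : x ∈ mu -> y ∈ mu -> [\/ x ∈ y, x = y | y ∈ x].
  by move=> xmu ymu; apply: ordinal_trich; apply: ordinal_mem omu _.
case: (T _ _ (maxV_mem amu bmu) (maxV_mem cmu dmu)) => [h|e|h].
- by constructor 1; left.
- rewrite e; case: (T _ _ amu cmu) => [h|->|h].
  + by constructor 1; right; split=> //; left.
  + case: (T _ _ bmu dmu) => [h|->|h]; last by constructor 3; right; split=> //;
    right.
      by constructor 1; right; split=> //; right.
    by constructor 2.
  + by constructor 3; right; split=> //; left.
- by constructor 3; left.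
Qed.

(** Hessenberg's theorem, by induction on [mu]: the collapse of Gödel's order on pairs is injective
    with ordinal values, and every value lies below [mu] because a pair has fewer than [mu]
    predecessors. *)
Lemma infinite_cardinal_square mu : infinite_cardinal mu ->
  elts mu `*` elts mu #<= elts mu.
Proof.
elim: mu / (memV_wf mu) => mu _ IH [cmu imu]; have omu := cmu.1.
pose S := elts mu `*` elts mu.
pose R p q := [/\ S p, S q & goedel_lt p q].
have wfR : well_founded R.
  move=> p; elim: p / (goedel_wf p) => p _ IHp; constructor=> q [_ _ qp];
    exact: IHp.
have [|pi piE] := collapse_ex wfR.
  move=> q; apply: (@small_sub _ _ S); first by move=> p [].
  by apply: small_prod; apply: small_elts.
have piP q y : y ∈ pi q <-> exists2 p, R p q & pi p = y.
  by rewrite -[y ∈ pi q]/(elts (pi q) y) piE.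
have tpi q : transV (pi q).
  move=> _ /piP[p pq <-] _ /piP[r rp <-]; apply/piP; exists r => //.
  case: pq rp => Sp Sq pq [Sr _ rp]; split=> //; exact: goedel_trans Sq rp pq.
have opi q : ordinal_set (pi q) by split=> // _ /piP[p _ <-].
apply: (@card_le_inj _ _ _ _ pi) => [p Sp|p q Sp Sq pq]; last first.
  case: (goedel_total omu Sp Sq) => // h; exfalso; apply: (@memV_irr (pi p)).
    by rewrite {2}pq; apply/piP; exists p.
  by rewrite {1}pq; apply/piP; exists q.
(* Otherwise [mu] is included in [pi p], so [p] has at least [mu] predecessors. *)
apply: contrapT => /(ordinal_leVN (opi p) omu) /(leV_sub (opi p)) /subset_card_le.
rewrite piE => /card_le_trans/(_ (card_image_le _ _)) muR.
pose m := maxV p.1 p.2; have mmu : m ∈ mu by case: Sp => ? ?; exact: maxV_mem.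
pose M := elts m `|` [set m].
(* Both coordinates of a predecessor of [p] are at most [m], hence lie in the successor [M] of
   [m]. *)
have {}muR : elts mu #<= M `*` M.
  apply: card_le_trans muR _; apply: subset_card_le => q [[/= q1 q2] _ qp].
  have om := ordinal_mem omu mmu.
  have [l1 l2] := maxV_le (ordinal_mem omu q1) (ordinal_mem omu q2).
  have ME x : leV x (maxV q.1 q.2) -> M x.
    move=> xq; suff: leV x m by case=> [|->]; [left|right].
    by case: qp => [qp|[qp _]]; [left; apply: leV_memV qp|rewrite /m -qp].
  by split; apply: ME.
have om := ordinal_mem omu mmu.
(* A finite [m] would make [mu] finite. Otherwise [M] has the size of an infinite cardinal [k] below
   [mu], whose square is [k] by induction. *)
have [fm|im] := pselect (finite_set (elts m)).
  apply: imu; apply: (card_le_finite muR).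
  have fM : finite_set M by rewrite finite_setU; split=> //; exact: finite_set1.
  exact: finite_setX.
have [k [ck km kE]] := cardinality_ex om.
have kmu : k ∈ mu by apply: leV_memV mmu.
have mk : elts m #<= elts k by case/card_eqPle: kE.
have Mk : M #<= elts k by apply: card_le_trans mk; exact: infinite_card_setU1.
have ik : infinite_set (elts k) by move=> /(card_le_finite mk).
apply: (cardinal_not_le cmu kmu).
apply: card_le_trans muR _.
exact: card_le_trans (card_le_prod m m Mk Mk) (IH k kmu (conj ck ik)).
Qed.

(** * Ordinals in the constructible hierarchy *)

Definition fo_all n (f : fo n.+1) : fo n := FNot (FEx (FNot f)).
Definition fo_imp n (f g : fo n) : fo n := FNot (FAnd f (FNot g)).

Lemma fsat_all (M : set V) n (f : fo n.+1) e :
  fsat M (fo_all f) e <-> forall x, M x -> fsat M f [tuple of x :: e].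
Proof.
split=> [/= h x Mx|h /= [x Mx]]; last by apply; apply: h.
by apply: contrapT => nf; apply: h; exists x.
Qed.

Lemma fsat_imp (M : set V) n (f g : fo n) e :
  fsat M (fo_imp f g) e <-> (fsat M f e -> fsat M g e).
Proof.
by split=> [/= h fe|h /= [/h]//]; apply: contrapT => ng; apply: h.
Qed.

Definition fo_trans n (i : 'I_n) : fo n :=
  fo_all (fo_imp (FIn ord0 (lift ord0 i))
    (fo_all (fo_imp (FIn ord0 (lift ord0 ord0))
      (FIn ord0 (lift ord0 (lift ord0 i)))))).

Definition fo_ordinal : fo 1 :=
  FAnd (fo_trans ord0)
    (fo_all (fo_imp (FIn ord0 (lift ord0 ord0)) (fo_trans ord0))).

Lemma fsat_in (M : set V) n (i j : 'I_n) e :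
  fsat M (FIn i j) e = (tnth e i ∈ tnth e j).
Proof. by []. Qed.

(** Absoluteness: the level is transitive, so its quantifiers already range over all elements that
    matter. *)
Lemma fsat_trans a n (i : 'I_n) e : transV a -> constructible a (tnth e i) ->
  fsat (constructible a) (fo_trans i) e <-> transV (tnth e i).
Proof.
move=> ta ai; rewrite fsat_all; split=> [h y yi z zy|h y ay].
  have ay : constructible a y by apply: constructible_trans ai yi.
  have az : constructible a z by apply: constructible_trans ay zy.
  have /fsat_imp := h y ay;
    rewrite fsat_in tnth0 tnthS => /(_ yi) /fsat_all /(_ z az).
  by move=> /fsat_imp; rewrite !fsat_in !tnth0 !tnthS tnth0; apply.
apply/fsat_imp; rewrite fsat_in tnth0 tnthS => yi.
apply/fsat_all => z az; apply/fsat_imp.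
by rewrite !fsat_in !tnth0 !tnthS tnth0; apply: h.
Qed.

Lemma fsat_ordinal a y : transV a -> constructible a y ->
  fsat (constructible a) fo_ordinal [tuple y] <-> ordinal_set y.
Proof.
move=> ta ay; have -> : fsat (constructible a) fo_ordinal [tuple y] =
    (fsat (constructible a) (fo_trans ord0) [tuple y] /\
     fsat (constructible a) (fo_all (fo_imp (FIn ord0 (lift ord0 ord0))
       (fo_trans ord0))) [tuple y]) by [].
rewrite fsat_trans ?tnth0 // fsat_all; split=> -[ty h]; split=> // b.
  move=> yb; have ab := constructible_trans ta ay yb.
  move/fsat_imp : (h b ab).
  by rewrite fsat_in fsat_trans ?tnth0 ?tnthS ?tnth0 //; apply.
move=> ab; apply/fsat_imp; rewrite fsat_in fsat_trans ?tnth0 ?tnthS ?tnth0 //.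
exact: h.
Qed.

Lemma constructible_sub_Def a b x :
  b ∈ a -> Def (constructible b) x -> constructible a x.
Proof. by move=> ba h; rewrite constructibleE; exists b. Qed.

(** Such a [y] is a subset of some earlier level [c], and by induction its elements are below [c];
    hence [y] is at most [c]. *)
Lemma ordinal_constructible_lt a y :
  ordinal_set a -> ordinal_set y -> constructible a y -> y ∈ a.
Proof.
elim: a / (memV_wf a) y => a _ IH y oa oy.
rewrite constructibleE => -[c ca [n [f [p [_ yE]]]]].
have oc := ordinal_mem oa ca.
apply: leV_memV (ca) => //; apply: sub_leV => // z zy.
have : elts y z by []; rewrite yE => -[cz _].
by apply: IH => //; apply: ordinal_mem zy.
Qed.

(** [a] is exactly the set of ordinals of its level, so [fo_ordinal] defines it without
    parameters. *)
Lemma ordinal_Def a : ordinal_set a -> Def (constructible a) a.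
Proof.
elim: a / (memV_wf a) => a _ IH oa.
exists 0, fo_ordinal, [tuple]; split=> [[]//|].
have E (y : V) : [tuple of y :: [tuple]] = [tuple y] by apply: val_inj.
apply/seteqP; split=> [y ya|y [ay]].
  have oy := ordinal_mem oa ya.
  have ay : constructible a y by apply: constructible_sub_Def ya (IH _ ya oy).
  by split=> //; rewrite E; apply/fsat_ordinal => //; case: oa.
rewrite E => /fsat_ordinal; case: (oa) => ta _ /(_ ta ay) oy.
exact: ordinal_constructible_lt.
Qed.

Lemma ordinal_sub_constructible a : ordinal_set a -> elts a `<=` constructible a.
Proof.
move=> oa b ba; apply: constructible_sub_Def (ba) _.
exact: ordinal_Def (ordinal_mem oa ba).
Qed.

(** * Formulas are countable *)

(** The number of free variables is not stored: the decoder receives it and checks each variable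
    index against it. *)
Fixpoint fo_code n (f : fo n) : GenTree.tree nat :=
  match f with
  | FEq _ i j => GenTree.Node 0 [:: GenTree.Leaf (val i); GenTree.Leaf (val j)]
  | FIn _ i j => GenTree.Node 1 [:: GenTree.Leaf (val i); GenTree.Leaf (val j)]
  | FNot _ g => GenTree.Node 2 [:: fo_code g]
  | FAnd _ g h => GenTree.Node 3 [:: fo_code g; fo_code h]
  | FEx _ g => GenTree.Node 4 [:: fo_code g]
  end.

Fixpoint fo_decode (t : GenTree.tree nat) n : option (fo n) :=
  match t with
  | GenTree.Node 0 [:: GenTree.Leaf i; GenTree.Leaf j] =>
      obind (fun i => omap (FEq i) (insub j)) (insub i : option 'I_n)
  | GenTree.Node 1 [:: GenTree.Leaf i; GenTree.Leaf j] =>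
      obind (fun i => omap (FIn i) (insub j)) (insub i : option 'I_n)
  | GenTree.Node 2 [:: g] => omap (@FNot n) (fo_decode g n)
  | GenTree.Node 3 [:: g; h] =>
      obind (fun g => omap (FAnd g) (fo_decode h n)) (fo_decode g n)
  | GenTree.Node 4 [:: g] => omap (@FEx n) (fo_decode g n.+1)
  | _ => None
  end.

Lemma fo_codeK n (f : fo n) : fo_decode (fo_code f) n = Some f.
Proof.
elim: f => {n} [n i j|n i j|n g IH|n g IHg h IHh|n g IH] /=;
  by rewrite ?valK /= ?valK ?IH ?IHg /= ?IHh.
Qed.

(** * The size of the constructible hierarchy *)

Lemma sval_inj T (P : T -> Prop) (x y : {x | P x}) : sval x = sval y -> x = y.
Proof. by case: x y => x px [y py] /= e; apply: eq_exist. Qed.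

Section Covered.
Variables (mu : V) (Hmu : infinite_cardinal mu).

Definition idx : Type := {x : V | x ∈ mu}.

(** Size at most [mu]. Since the range may exceed [S], the empty class needs no special case. *)
Definition covered T (S : set T) : Prop := exists g : idx -> T, S `<=` range g.

Lemma idx_inh : inhabited idx.
Proof. by have [x xmu] := infinite_setN0 Hmu.2; split; exists x. Qed.

Lemma left_inverse_ex A B (a0 : A) (f : A -> B) : injective f ->
  exists g : B -> A, cancel f g.
Proof.
move=> fi;
  have /choice[g gP] : forall b, exists a, (exists a', f a' = b) -> f a = b.
  move=> b; have [[a fa]|n] := pselect (exists a', f a' = b); first by exists a.
  by exists a0 => /n.
by exists g => a; apply: fi; apply: gP; exists a.
Qed.

Lemma idx_pair_ex : exists u : idx -> idx * idx, forall p, exists d, u d = p.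
Proof.
have [d0] := idx_inh.
have [f [fmu fi]] := card_le_exinj mu (infinite_cardinal_square Hmu).
have fP (p : idx * idx) : f (sval p.1, sval p.2) ∈ mu.
  by apply: fmu; split; apply: svalP.
have fpi : injective (fun p : idx * idx => exist (fun x => x ∈ mu) _ (fP p)).
  move=> [[x xm] [y ym]] [[x' xm'] [y' ym']] /(congr1 sval) /= /fi.
  case/(_ (conj xm ym) (conj xm' ym')) => ? ?; subst x' y'.
  by congr (_, _); apply: eq_exist.
have [g gK] := left_inverse_ex (d0, d0) fpi.
by exists g => p; eexists; apply: gK.
Qed.

Lemma idx_nat_ex : exists u : idx -> nat, forall n, exists d, u d = n.
Proof.
have /infiniteP/(card_le_exinj mu)[f [fmu fi]] := Hmu.2.
have fni : injective (fun n => exist (fun x => x ∈ mu) (f n) (fmu n I)).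
  by move=> m n /(congr1 sval) /= /fi; apply.
have [g gK] := left_inverse_ex 0 fni.
by exists g => n; eexists; apply: gK.
Qed.

Lemma idx_tuple_ex n : exists u : idx -> n.-tuple idx, forall t, exists d, u d = t.
Proof.
have [d0] := idx_inh; have [u uP] := idx_pair_ex.
elim: n => [|n [v vP]].
  by exists (fun=> [tuple]) => t; exists d0; rewrite [t]tuple0.
exists (fun d => [tuple of (u d).1 :: v (u d).2]) => t; case/tupleP: t => x t.
by have [d dt] := vP t; have [e eE] := uP (x, d); exists e; rewrite eE /= dt.
Qed.

(** Names for the definable subsets of a structure on [idx]: a formula together with parameters for
    all variables but the first. *)
Definition fo_inst : Type := {n : nat & (fo n.+1 * n.-tuple idx)%type}.

Lemma idx_inst_ex : exists u : idx -> fo_inst, forall t, exists d, u d = t.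
Proof.
have [u uP] := idx_pair_ex; have [v vP] := idx_nat_ex.
pose w n := projT1 (cid (idx_tuple_ex n)).
have wP n t : exists d, w n d = t := projT2 (cid (idx_tuple_ex n)) t.
(* Numbers that code no formula in [n.+1] variables decode to a default formula. *)
pose dec n k : fo n.+1 :=
  odflt (FEq ord0 ord0) (obind (fun t => fo_decode t n.+1) (unpickle k)).
exists (fun d => let n := v (u d).1 in
  existT _ n (dec n (v (u (u d).2).1), w n (u (u d).2).2)) => -[n [f t]].
have [d1 e1] := vP n; have [d2 e2] := vP (pickle (fo_code f)).
have [d3 e3] := wP n t; have [d4 e4] := uP (d2, d3); have [d e] := uP (d1, d4).
by exists d; rewrite e /= e1 e4 /= e2 e3 /dec pickleK /= fo_codeK.
Qed.

Lemma covered_bigcup (S : set V) (F : V -> set V) : covered S ->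
  (forall x, S x -> covered (F x)) -> covered (\bigcup_(x in S) F x).
Proof.
move=> [g gS] FS; have [u uP] := idx_pair_ex.
have /choice[G GP] : forall x, exists G : idx -> V, S x -> F x `<=` range G.
  move=> x; have [/FS[G GF]|nS] := pselect (S x); first by exists G.
  by exists (fun=> mu).
exists (fun d => G (g (u d).1) (u d).2) => y [x Sx Fxy].
have [d1 _ e1] := gS x Sx; have [d2 _ e2] := GP x Sx y Fxy.
by have [d e] := uP (d1, d2); exists d => //; rewrite e /= e1.
Qed.

Lemma toV_elts x : toV (elts x) = x.
Proof. by apply: elts_inj; apply: toVE; apply: small_elts. Qed.

(** A definable subset is determined by a formula and parameters named through the covering of [M],
    and [idx] enumerates these data. *)
Lemma covered_Def (M : set V) : covered M -> covered (Def M).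
Proof.
move=> [g gM]; have [u uP] := idx_inst_ex.
exists (fun d => let: existT n (f, t) := u d in
  toV [set y | M y /\ fsat M f [tuple of y :: map_tuple g t]]).
move=> x [n [f [p [pM xE]]]].
have /choice[h hP] : forall i, exists d, g d = tnth p i.
  by move=> i; have [d _ de] := gM _ (pM i); exists d.
have [d dE] := uP (existT _ n (f, [tuple h i | i < n])); exists d => //.
rewrite dE -[RHS]toV_elts xE.
suff -> : map_tuple g [tuple h i | i < n] = p by [].
by apply: eq_from_tnth => i; rewrite tnth_map tnth_mktuple.
Qed.

Lemma covered_constructible la : ordinal_set la ->
  (forall a, a ∈ la -> covered (elts a)) ->
  forall a, a ∈ la -> covered (constructible a).
Proof.
move=> ola cla a; elim: a / (memV_wf a) => a _ IH ala.
have [|g gP] := covered_bigcup (F := fun b => Def (constructible b)) (cla a ala).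
  by move=> b ba; apply: covered_Def; apply: IH => //; apply: ordinal_trans ba.
by exists g => x; rewrite constructibleE => -[b ba h]; apply: gP; exists b.
Qed.

Lemma covered_inj T (S : set T) : covered S ->
  exists h : T -> idx, forall x y, S x -> S y -> h x = h y -> x = y.
Proof.
have [d0] := idx_inh.
move=> [g gS]; have /choice[h hP] : forall x, exists d, S x -> g d = x.
  move=> x; have [/gS[d _ dx]|n] := pselect (S x); first by exists d.
  by exists d0 => /n.
by exists h => x y Sx Sy e; rewrite -(hP x) // e hP.
Qed.

Lemma card_le_covered (S : set V) : S #<= elts mu -> covered S.
Proof.
move=> /(card_le_exinj mu)[f [fmu fi]].
have /choice[g gP] : forall d : idx, exists x, forall y, S y -> f y = sval d -> x = y.
  move=> d; have [[y [Sy yd]]|n] := pselect (exists y, S y /\ f y = sval d).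
    by exists y => z Sz zd; apply: fi => //; rewrite yd.
  by exists mu => y Sy yd; case: n; exists y.
exists g => x Sx; exists (exist _ (f x) (fmu x Sx)) => //.
exact: gP.
Qed.

Lemma small_covered T (S : set T) : covered S -> small S.
Proof.
move=> [g gS]; apply: small_sub gS _; apply: small_image; exact: small_sig.
Qed.

End Covered.

(** * Ordinals and index types below a successor cardinal *)

Section SuccessorCardinal.
Variables (mu la : V) (Hmu : infinite_cardinal mu) (Hla : successor_cardinal mu la).

Lemma successor_ordinal : ordinal_set la.
Proof. by case: Hla => -[]. Qed.

Lemma successor_not_le : ~ (elts la #<= elts mu).
Proof. by case: Hla => cla mula _; apply: cardinal_not_le. Qed.

(** The cardinality of [a] is a cardinal below [la], hence at most [mu] by minimality of [la]. *)
Lemma successor_covered a : a ∈ la -> covered mu (elts a).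
Proof.
case: Hla => cla _ minla ala; have oa := ordinal_mem successor_ordinal ala.
have [k [ck ka /card_eqPle[_ ak]]] := cardinality_ex oa.
apply: card_le_covered; apply: card_le_trans ak _; apply: subset_card_le.
have omu := Hmu.1.1; have ok := ck.1.
apply: leV_sub => //; apply: ordinal_leVN => // muk.
have lak := minla k ck muk; apply: (@memV_irr la).
apply: leV_memV lak _; first exact: successor_ordinal.
by apply: leV_memV ka ala; apply: successor_ordinal.
Qed.

(** A largest element [b] would give [la] the size of [b], since adding one point to an infinite set
    keeps its size. *)
Lemma successor_limit b : b ∈ la -> exists2 c, c ∈ la & b ∈ c.
Proof.
case: Hla => cla mula _ bla; apply: contrapT => h.
have le c : c ∈ la -> leV c b.
  move=> cl; apply: ordinal_leVN; try exact: ordinal_mem successor_ordinal _.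
  by move=> bc; apply: h; exists c.
apply: (cardinal_not_le cla bla).
apply: card_le_trans (infinite_card_setU1 b _); last first.
  apply: sub_infinite_set Hmu.2; apply: leV_sub (le _ mula).
  exact: ordinal_mem successor_ordinal bla.
by apply: subset_card_le => c /le[]; [left|right].
Qed.

(** Size at most [mu], hence admissible for conjunctions, disjunctions and blocks of quantifiers. *)
Definition index_small (I : Type) : Prop := exists f : I -> idx mu, injective f.

Lemma index_small_card I : index_small I -> card_lt [set: I] (elts la).
Proof.
case: Hla => cla mula _ [f fi].
have Imu : [set: I] #<= elts mu.
  apply: (@card_le_inj _ _ _ _ (fun i => sval (f i))) => [i _|i j _ _ e].
    exact: svalP.
  by apply: fi; apply: sval_inj.
split; last by move=> /card_le_trans/(_ Imu); exact: successor_not_le.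
apply: card_le_trans Imu _; apply: subset_card_le; apply: leV_sub; last by left.
exact: successor_ordinal.
Qed.

Lemma surj_index_small I (u : idx mu -> I) :
  (forall i, exists d, u d = i) -> index_small I.
Proof.
by move=> /choice[f fK]; exists f => i j e; rewrite -(fK i) e.
Qed.

Lemma index_small_inj I J (f : I -> J) : injective f ->
  index_small J -> index_small I.
Proof. by move=> fi [g gi]; exists (g \o f); apply: inj_comp. Qed.

Lemma index_small_nat : index_small nat.
Proof. by have [u /surj_index_small] := idx_nat_ex Hmu. Qed.

Lemma index_small_count (I : countType) : index_small I.
Proof. by apply: index_small_inj (pcan_inj (@pickleK I)) index_small_nat. Qed.

Lemma index_small_idx : index_small (idx mu).
Proof. by exists id. Qed.

Lemma index_small_pair : index_small (idx mu * idx mu).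
Proof. by have [u /surj_index_small] := idx_pair_ex Hmu. Qed.

Lemma index_small_inst : index_small (fo_inst mu).
Proof. by have [u /surj_index_small] := idx_inst_ex Hmu. Qed.

Lemma index_small_elts a : a ∈ la -> index_small {b | b ∈ a}.
Proof.
move=> /successor_covered/(covered_inj Hmu)[f fi].
exists (fun b => f (sval b)) => -[b ba] [c ca] /= /fi e.
by apply: eq_exist; apply: e.
Qed.

(** * Definability in the infinitary logic *)

(** Semantic definability, uniform in the predicate [A]. The closure lemmas below build formulas
    without writing their syntax. *)
Definition definable X (P : set V -> (X -> idx la) -> Prop) : Prop :=
  exists f : Linf la X, forall A e,
    Lsat (fun a b => sval a ∈ sval b) (fun a => A (sval a)) f e <-> P A e.

Lemma definable_ext X (P Q : set V -> (X -> idx la) -> Prop) :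
  (forall A e, P A e <-> Q A e) -> definable P -> definable Q.
Proof. by move=> PQ [f fP]; exists f => A e; rewrite fP. Qed.

Lemma definable_lt X (x y : X) : definable (fun _ e => sval (e x) ∈ sval (e y)).
Proof. by exists (LLt la x y). Qed.

Lemma definable_eq X (x y : X) : definable (fun _ e => e x = e y).
Proof. by exists (LEq la x y). Qed.

Lemma definable_in X (x : X) : definable (fun A e => A (sval (e x))).
Proof. by exists (LP la x). Qed.

Lemma definable_not X (P : set V -> (X -> idx la) -> Prop) :
  definable P -> definable (fun A e => ~ P A e).
Proof. by move=> [f fP]; exists (LNot f) => A e /=; rewrite fP. Qed.

Lemma definable_forall X I (P : I -> set V -> (X -> idx la) -> Prop) :
  index_small I -> (forall i, definable (P i)) ->
  definable (fun A e => forall i, P i A e).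
Proof.
move=> /index_small_card sI /choice[f fP]; exists (LAnd sI f) => A e /=.
by split=> h i; apply/fP.
Qed.

Lemma definable_exists X I (P : I -> set V -> (X -> idx la) -> Prop) :
  index_small I -> (forall i, definable (P i)) ->
  definable (fun A e => exists i, P i A e).
Proof.
move=> /index_small_card sI /choice[f fP]; exists (LOr sI f) => A e /=.
by split=> -[i h]; exists i; apply/fP.
Qed.

Lemma definable_forall_block X Y (P : set V -> (X -> idx la) -> (Y -> idx la) -> Prop) :
  index_small Y ->
  definable (fun A (e : X + Y -> idx la) =>
    P A (fun x => e (inl x)) (fun y => e (inr y))) ->
  definable (fun A e => forall e', P A e e').
Proof.
move=> /index_small_card sY [f fP]; exists (LAll sY f) => A e /=.
by split=> h e'; [have /fP := h e'|apply/fP; apply: h].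
Qed.

Lemma definable_exists_block X Y (P : set V -> (X -> idx la) -> (Y -> idx la) -> Prop) :
  index_small Y ->
  definable (fun A (e : X + Y -> idx la) =>
    P A (fun x => e (inl x)) (fun y => e (inr y))) ->
  definable (fun A e => exists e', P A e e').
Proof.
move=> /index_small_card sY [f fP]; exists (LEx sY f) => A e /=.
by split=> -[e' h]; exists e'; [have /fP := h|apply/fP; apply: h].
Qed.

Lemma definable_forall1 X (P : set V -> (X -> idx la) -> idx la -> Prop) :
  definable (fun A (e : X + unit -> idx la) => P A (fun x => e (inl x)) (e (inr tt))) ->
  definable (fun A e => forall a, P A e a).
Proof.
move=> h; apply: definable_ext (definable_forall_block
  (P := fun A e e' => P A e (e' tt)) (index_small_count unit) h).
by move=> A e; split=> {}h a; [apply: (h (fun=> a))|apply: h].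
Qed.

Lemma definable_exists1 X (P : set V -> (X -> idx la) -> idx la -> Prop) :
  definable (fun A (e : X + unit -> idx la) => P A (fun x => e (inl x)) (e (inr tt))) ->
  definable (fun A e => exists a, P A e a).
Proof.
move=> h; apply: definable_ext (definable_exists_block
  (P := fun A e e' => P A e (e' tt)) (index_small_count unit) h).
by move=> A e; split=> -[a {}h]; [exists (a tt)|exists (fun=> a)].
Qed.

Lemma definable_and X (P Q : set V -> (X -> idx la) -> Prop) :
  definable P -> definable Q -> definable (fun A e => P A e /\ Q A e).
Proof.
move=> dP dQ; apply: definable_ext (definable_forall (index_small_count bool)
  (P := fun b => if b then P else Q) _) => [A e|[]//].
by split=> [h|[? ?] []//]; split; [exact: (h true)|exact: (h false)].
Qed.

Lemma definable_imp X (P Q : set V -> (X -> idx la) -> Prop) :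
  definable P -> definable Q -> definable (fun A e => P A e -> Q A e).
Proof.
move=> dP dQ; have := definable_not (definable_and dP (definable_not dQ)).
apply: definable_ext => A e; split=> [h p|h [/h]//].
by apply: contrapT => nq; apply: h.
Qed.

Lemma definable_iff X (P Q : set V -> (X -> idx la) -> Prop) :
  definable P -> definable Q -> definable (fun A e => P A e <-> Q A e).
Proof. by move=> dP dQ; apply: definable_and; apply: definable_imp. Qed.

(** Truth is the empty conjunction and falsity the empty disjunction. This settles facts about fixed
    indices, which do not depend on the variables. *)
Lemma definable_const X (Q : Prop) : definable (fun _ (_ : X -> idx la) => Q).
Proof.
have [q|nq] := pselect Q.
  exists (LAnd (index_small_card (index_small_count void)) (of_void _)) => A e /=.
  by split=> // _ [].
exists (LOr (index_small_card (index_small_count void)) (of_void _)) => A e /=.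
by split=> [[[]]|].
Qed.

(** By induction on [a]: the elements of [x] are the [c] below [a], a disjunction over at most [mu]
    indices. *)
Lemma definable_ordinal X (x : X) a : a ∈ la ->
  definable (fun _ e => sval (e x) = a).
Proof.
elim: a / (memV_wf a) X x => a _ IH X x ala.
have H : definable (fun _ (e : X -> idx la) => forall u : idx la,
    sval u ∈ sval (e x) <-> exists c : {c | c ∈ a}, sval u = sval c).
  apply: definable_forall1; apply: definable_iff; first exact: definable_lt.
  apply: definable_exists; first exact: index_small_elts.
  move=> [c ca]; apply: IH => //.
  by apply: ordinal_trans ca; first exact: successor_ordinal.
apply: definable_ext H => _ e; have ex := svalP (e x); split=> [h|h u].
  apply: sets_ext => y; split=> [yx|ya].
    have yla : y ∈ la by apply: ordinal_trans yx; first exact: successor_ordinal.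
    by have [[c ca] /= ->] := (h (exist _ y yla)).1 yx.
  have yla : y ∈ la by apply: ordinal_trans ya; first exact: successor_ordinal.
  by apply/(h (exist _ y yla)); exists (exist _ y ya).
rewrite h; split=> [ua|[[c ca] /= -> //]]; by exists (exist _ (sval u) ua).
Qed.

End SuccessorCardinal.

(** * Coding levels of the constructible hierarchy *)

(** Satisfaction in a structure with an arbitrary relation [E] in place of membership. *)
Fixpoint msat D (M : set D) (E : D -> D -> Prop) n (f : fo n) : n.-tuple D -> Prop :=
  match f in fo n return n.-tuple D -> Prop with
  | FEq _ i j => fun t => tnth t i = tnth t j
  | FIn _ i j => fun t => E (tnth t i) (tnth t j)
  | FNot _ g => fun t => ~ msat M E g t
  | FAnd _ g h => fun t => msat M E g t /\ msat M E h t
  | FEx _ g => fun t => exists x, M x /\ msat M E g [tuple of x :: t]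
  end.

Lemma map_tuple_cons T U (f : T -> U) n x (t : n.-tuple T) :
  map_tuple f [tuple of x :: t] = [tuple of f x :: map_tuple f t].
Proof. exact: val_inj. Qed.

Lemma forall_tnth_cons T (P : T -> Prop) n x (t : n.-tuple T) :
  P x -> (forall l, P (tnth t l)) -> forall l, P (tnth [tuple of x :: t] l).
Proof.
move=> Px Pt l; case: (unliftP ord0 l) => [m ->|->]; last by rewrite tnth0.
by rewrite tnthS.
Qed.

Lemma msat_iso D (M : set D) (E : D -> D -> Prop) (pi : D -> V) :
  (forall i j, M i -> M j -> pi i = pi j -> i = j) ->
  (forall i j, M i -> M j -> E i j <-> pi i ∈ pi j) ->
  forall n (f : fo n) t, (forall l, M (tnth t l)) ->
    msat M E f t <-> fsat (pi @` M) f (map_tuple pi t).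
Proof.
move=> pinj piE n f.
elim: f => {n} [n i j|n i j|n g IH|n g IHg h IHh|n g IH] t tM /=.
- by rewrite !tnth_map; split=> [->//|]; apply: pinj.
- by rewrite !tnth_map; apply: piE.
- by rewrite IH.
- by rewrite IHg // IHh.
- split=> [[x [Mx]]|[_ [x Mx <-]]].
    rewrite IH; last exact: forall_tnth_cons.
    by rewrite map_tuple_cons => h; exists (pi x) => //; exists x.
  rewrite -map_tuple_cons -IH; last exact: forall_tnth_cons.
  by exists x.
Qed.

Lemma least_ordinal (P : V -> Prop) : (exists c, ordinal_set c /\ P c) ->
  exists c, [/\ ordinal_set c, P c & forall c', ordinal_set c' -> P c' -> leV c c'].
Proof.
move=> [c [oc Pc]]; elim: c / (memV_wf c) oc Pc => c _ IH oc Pc.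
have [[d dc Pd]|n] := pselect (exists2 d, d ∈ c & P d).
  by apply: (IH d) => //; apply: ordinal_mem dc.
exists c; split=> // d od Pd; apply: ordinal_leVN => // dc.
by apply: n; exists d.
Qed.

Section Code.
Variables (mu la : V) (Hmu : infinite_cardinal mu) (Hla : successor_cardinal mu la).

Let D := idx mu.
Let ola : ordinal_set la := successor_ordinal Hla.

(** The rank of a point is the stage over which it is definable, so these points are to form the
    level [b]. *)
Definition rank_lt (r : D -> idx la) (b : V) : set D := [set d | sval (r d) ∈ b].

Definition params_lt (r : D -> idx la) (b : V) (q : fo_inst mu) : Prop :=
  forall l, rank_lt r b (tnth (projT2 q).2 l).

Definition realises (a : V) (E : D -> D -> Prop) (r : D -> idx la) (b : V)
    (q : fo_inst mu) (i : D) : Prop :=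
  forall k, rank_lt r a k -> (E k i <-> rank_lt r b k /\
    msat (rank_lt r b) E (projT2 q).1 [tuple of k :: (projT2 q).2]).

(* The points of rank below [a] form, under [E], a copy of [constructible a] in
   which a point [i] with [o i ∈ a] stands for the ordinal [o i]. *)
Definition level_code (a : idx la) (E : D -> D -> Prop) (r o : D -> idx la) : Prop :=
  [/\ forall i j, rank_lt r (sval a) i -> rank_lt r (sval a) j ->
        (forall k, rank_lt r (sval a) k -> (E k i <-> E k j)) -> i = j,
      forall i, rank_lt r (sval a) i -> exists q,
        params_lt r (sval (r i)) q /\ realises (sval a) E r (sval (r i)) q i,
      forall b : idx la, sval b ∈ sval a -> forall q, params_lt r (sval b) q ->
        exists i, ~ (sval b ∈ sval (r i)) /\ realises (sval a) E r (sval b) q i &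
      forall i, rank_lt r (sval a) i -> sval (o i) ∈ sval a ->
        (forall k, rank_lt r (sval a) k -> E k i -> sval (o k) ∈ sval (o i)) /\
        (forall c : idx la, sval c ∈ sval (o i) ->
           exists k, rank_lt r (sval a) k /\ (E k i /\ o k = c))].

(** [pi] is the collapse of [E]. Induction on [b] shows that the points of rank below [b] collapse
    onto [constructible b], and a further induction identifies the points that stand for
    ordinals. *)
Lemma level_code_iso a E r o : level_code a E r o -> exists pi : D -> V,
  [/\ forall i j, rank_lt r (sval a) i -> rank_lt r (sval a) j -> pi i = pi j -> i = j,
      forall i j, rank_lt r (sval a) i -> rank_lt r (sval a) j -> E i j <-> pi i ∈ pi j,
      pi @` rank_lt r (sval a) = constructible (sval a) &
      forall i, rank_lt r (sval a) i -> sval (o i) ∈ sval a -> pi i = sval (o i)].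
Proof.
case: a => a ala [/= H1 H2 H3 H4].
have oa := ordinal_mem ola ala.
(* The drop in rank makes [R] well-founded; [E_lt] shows that on the coded points every [E]-edge has
   this drop. *)
pose R k i := rank_lt r a i /\ (rank_lt r (sval (r i)) k /\ E k i).
have wfR : well_founded R.
  move=> i; have [c rc] : exists c, sval (r i) = c by eexists.
  elim: c / (memV_wf c) i rc => c _ IH i rc; constructor=> k [_ [ki _]].
  by apply: IH (erefl _); rewrite -rc.
have [|pi piE] := collapse_ex wfR.
  by move=> i; apply: small_sub (@subsetT _ _) (small_sig mu).
have lt_trans b k : leV b a -> rank_lt r b k -> rank_lt r a k.
  by move=> ba kb; apply: memV_leV ba.
have E_lt i k : rank_lt r a i -> rank_lt r a k -> E k i -> rank_lt r (sval (r i)) k.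
  by move=> ia ka; have [q [_ /(_ k ka) [h _]]] := H2 i ia => /h[].
have piP i y : rank_lt r a i ->
    y ∈ pi i <-> exists k, [/\ rank_lt r a k, E k i & pi k = y].
  move=> ia; rewrite -[y ∈ pi i]/(elts (pi i) y) piE; split.
    by move=> [k [_ [ki Eki]] <-]; exists k; split=> //; apply: lt_trans ki; left.
  move=> [k [ka Eki <-]]; exists k => //; split=> //; split=> //.
  exact: E_lt.
have pinj i j : rank_lt r a i -> rank_lt r a j -> pi i = pi j -> i = j.
  elim: i / (wfR i) j => i _ IH j ia ja pij; apply: H1 => // k ka; split=> Ek.
    have : pi k ∈ pi j by rewrite -pij; apply/piP => //; exists k.
    move=> /piP[//|k' [k'a Ek'j pk]]; rewrite (IH k _ k') //.
    by split=> //; split=> //; apply: E_lt.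
  have : pi k ∈ pi i by rewrite pij; apply/piP => //; exists k.
  move=> /piP[//|k' [k'a Ek'i pk]]; rewrite -(IH k' _ k) //.
  by split=> //; split=> //; apply: E_lt.
have Eiff i j : rank_lt r a i -> rank_lt r a j -> E i j <-> pi i ∈ pi j.
  move=> ia ja; split=> [Eij|/piP[//|k [ka Ekj]]]; first by apply/piP => //;
    exists i.
  by move=> /pinj <-.
(* Once the points below [b] collapse onto level [b], satisfaction transfers, so a point realising
   [q] collapses to the subset that [q] defines. *)
have realE b q i : b ∈ a -> rank_lt r a i -> pi @` rank_lt r b = constructible b ->
    params_lt r b q -> realises a E r b q i ->
    elts (pi i) = [set y | constructible b y /\
      fsat (constructible b) (projT2 q).1 [tuple of y :: map_tuple pi (projT2 q).2]].
  move=> ba ia Lb pq hi.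
  have sub k : rank_lt r b k -> rank_lt r a k by apply: lt_trans; left.
  have iso k : rank_lt r b k ->
      msat (rank_lt r b) E (projT2 q).1 [tuple of k :: (projT2 q).2] <->
      fsat (constructible b) (projT2 q).1
        [tuple of pi k :: map_tuple pi (projT2 q).2].
    move=> kb; rewrite -map_tuple_cons -Lb;
      apply: msat_iso => [x y xb yb|x y xb yb|].
    - by apply: pinj; apply: sub.
    - by apply: Eiff; apply: sub.
    - exact: forall_tnth_cons.
  apply/seteqP; split=> [y /(piP _ _ ia)[k [ka Eki <-]]|y [Ly fy]].
    have [kb /(iso k kb) h] := (hi k ka).1 Eki.
    by split=> //; rewrite -Lb; exists k.
  have : (pi @` rank_lt r b) y by rewrite Lb.
  move=> [k kb yk]; subst y; apply/(piP _ _ ia); exists k; split=> //;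
    first exact: sub.
  by apply/(hi k (sub k kb)); split=> //; apply/iso.
have img b : leV b a -> pi @` rank_lt r b = constructible b.
  elim: b / (memV_wf b) => b _ IH ba; apply/seteqP; split.
    move=> _ [i ib <-]; have ia := lt_trans b i ba ib.
    have [[n [f p]] [pq hi]] := H2 i ia.
    apply: (@constructible_sub_Def _ (sval (r i))) => //.
    have Li : pi @` rank_lt r (sval (r i)) = constructible (sval (r i)).
      by apply: IH => //; left.
    exists n, f, (map_tuple pi p); split; last exact: realE Li pq hi.
    by move=> l; rewrite tnth_map -Li; exists (tnth p l) => //; apply: pq.
  (* For the other inclusion, the third clause of the code gives a point of rank at most [c], hence
     below [b], for the subset [x] of level [c]. *)
  move=> x; rewrite constructibleE => -[c cb [n [f [p [pL xE]]]]].
  have ca : c ∈ a by apply: memV_leV ba.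
  have cla : c ∈ la by apply: ordinal_trans ca.
  have Lc : pi @` rank_lt r c = constructible c by apply: IH => //; left.
  have /choice[h hP] : forall l, exists d, rank_lt r c d /\ pi d = tnth p l.
    by move=> l; have := pL l; rewrite -Lc => -[d dc dp]; exists d.
  pose q : fo_inst mu := existT _ n (f, [tuple h l | l < n]).
  have pq : params_lt r c q by move=> l; rewrite tnth_mktuple; case: (hP l).
  have [i [nri hi]] := H3 (exist _ c cla) ca q pq.
  have ic : leV (sval (r i)) c.
    exact: ordinal_leVN (ordinal_mem ola cla) (ordinal_mem ola (svalP (r i))) nri.
  have ib : rank_lt r b i.
    by apply: leV_memV ic cb; case: ba => [/(ordinal_mem oa)|->].
  exists i => //; apply: elts_inj.
  rewrite (realE c q i) ?xE //; last exact: lt_trans ib.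
  suff -> : map_tuple pi (projT2 q).2 = p by [].
  by apply: eq_from_tnth => l; rewrite tnth_map tnth_mktuple; case: (hP l).
exists pi; split=> //; first by apply: img; right.
move=> i; elim: i / (wfR i) => i _ IH ia oia.
have [h1 h2] := H4 i ia oia.
apply: sets_ext => y; rewrite piP //; split=> [[k [ka Eki <-]]|yo].
  have oki := h1 k ka Eki; rewrite IH //; last by apply: ordinal_trans oki.
  by split=> //; split=> //; apply: E_lt.
have yla : y ∈ la := ordinal_trans ola (svalP (o i)) yo.
have [k [ka [Eki oky]]] := h2 (exist _ y yla) yo.
exists k; split=> //; rewrite IH ?oky //; last by apply: ordinal_trans yo.
by split=> //; split=> //; apply: E_lt.
Qed.

Lemma level_code_sat a E r o i j (f : fo 2) : level_code a E r o ->
  rank_lt r (sval a) i -> rank_lt r (sval a) j ->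
  sval (o i) ∈ sval a -> sval (o j) ∈ sval a ->
  msat (rank_lt r (sval a)) E f [tuple i; j] <->
  fsat (constructible (sval a)) f [tuple sval (o i); sval (o j)].
Proof.
move=> /level_code_iso[pi [pinj piE img piO]] ia ja oia oja.
rewrite -img -(piO i) // -(piO j) //.
have -> : [tuple pi i; pi j] = map_tuple pi [tuple i; j] by apply: val_inj.
apply: msat_iso => //.
have -> : [tuple i; j] = [tuple of i :: [tuple j]] by apply: val_inj.
by apply: forall_tnth_cons => // l; rewrite ord1 tnth0.
Qed.

(** Level [a] has size at most [mu], so an injection [h] into the indices, with partial inverse
    [pi], carries membership, ranks and ordinals over to them. *)
Lemma level_code_ex (a : idx la) : exists E r o, level_code a E r o /\
  forall x, x ∈ sval a -> exists i, rank_lt r (sval a) i /\ sval (o i) = x.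
Proof.
case: a => a ala; have oa := ordinal_mem ola ala.
have covL b : b ∈ la -> covered mu (constructible b).
  exact: (covered_constructible Hmu ola (successor_covered Hmu Hla)).
have [h hinj] := covered_inj Hmu (covL a ala).
pose dom d := exists2 x, constructible a x & h x = d.
have /choice[pi piP] : forall d, exists x, dom d -> constructible a x /\ h x = d.
  move=> d; have [[x ax xd]|n] := pselect (dom d); first by exists x.
  by exists a => /n.
have domh x : constructible a x -> dom (h x) by exists x.
have pih x : constructible a x -> pi (h x) = x.
  by move=> ax; have [? /hinj] := piP _ (domh x ax); apply.
have piL d : dom d -> constructible a (pi d) by case/piP.
have hpi d : dom d -> h (pi d) = d by case/piP.
(* Minimality of [rk x] makes membership of [x] in level [b] equivalent to [rk x ∈ b]. *)
have /choice[rk rkP] : forall x, exists c, constructible a x ->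
    [/\ c ∈ a, Def (constructible c) x & forall c', ordinal_set c' ->
        Def (constructible c') x -> leV c c'].
  move=> x; have [ax|n] := pselect (constructible a x); last by exists a.
  have [c [oc Pc cmin]] : exists c, [/\ ordinal_set c, Def (constructible c) x &
      forall c', ordinal_set c' -> Def (constructible c') x -> leV c c'].
    apply: least_ordinal; move: ax; rewrite constructibleE => -[c ca Pc].
    by exists c; split=> //; apply: ordinal_mem ca.
  exists c => _; split=> //; move: ax; rewrite constructibleE => -[d da Pd].
  by apply: leV_memV (da) => //; apply: cmin => //; apply: ordinal_mem da.
have subL b x : leV b a -> constructible b x -> constructible a x.
  by move=> ba; apply: constructible_mono; apply: leV_sub.
have rkL b x : leV b a -> constructible a x -> (constructible b x <-> rk x ∈ b).
  move=> ba ax; have [ra Dr rmin] := rkP x ax.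
  have ob : ordinal_set b by case: ba => [/(ordinal_mem oa)|->].
  split=> [|rb]; last exact: constructible_sub_Def Dr.
  rewrite constructibleE => -[c cb Dc]; apply: leV_memV (cb) => //.
  by apply: rmin => //; apply: ordinal_mem cb.
(* Indices outside [dom] get rank [a], so that the points of rank below [a] are exactly those of
   [dom]. *)
have /choice[r rP] : forall d, exists c : idx la,
    (dom d -> sval c = rk (pi d)) /\ (~ dom d -> sval c = a).
  move=> d; have [dd|n] := pselect (dom d); last by exists (exist _ a ala).
  have [ra _ _] := rkP _ (piL d dd).
  by exists (exist (fun x => x ∈ la) _ (ordinal_trans ola ala ra)).
(* The value [a] marks indices that stand for no ordinal below [a]. *)
have /choice[o oP] : forall d, exists c : idx la,
    (dom d /\ pi d ∈ a -> sval c = pi d) /\ (~ (dom d /\ pi d ∈ a) -> sval c = a).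
  move=> d; have [[dd da]|n] := pselect (dom d /\ pi d ∈ a);
    last by exists (exist _ a ala).
  by exists (exist (fun x => x ∈ la) _ (ordinal_trans ola ala da)); split=> // [[]].
have oltP d : sval (o d) ∈ a -> [/\ dom d, pi d ∈ a & sval (o d) = pi d].
  have [o1 o2] := oP d; have [[dd da]|n] := pselect (dom d /\ pi d ∈ a).
    by rewrite o1.
  by rewrite o2 // => /memV_irr.
have ltP b d : leV b a -> rank_lt r b d <-> dom d /\ constructible b (pi d).
  move=> ba; have [r1 r2] := rP d; rewrite /rank_lt /=; split=> [db|[dd]].
    have dd : dom d.
      apply: contrapT => nd; apply: (@memV_irr a); apply: memV_leV ba => //.
      by rewrite -(r2 nd).
    by split=> //; apply/rkL => //; [exact: piL|rewrite -r1].
  by rewrite r1 // => /rkL; apply=> //; apply: piL.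
have lta d : rank_lt r a d <-> dom d.
  by rewrite ltP; [split=> [[]|dd]//; split=> //; apply: piL|right].
have lth b x : leV b a -> constructible b x -> rank_lt r b (h x).
  move=> ba bx; have ax := subL b x ba bx; apply/ltP => //.
  by split; [exact: domh|rewrite pih].
pose E i j := pi i ∈ pi j.
have iso b n (f : fo n) t : leV b a -> (forall l, rank_lt r b (tnth t l)) ->
    msat (rank_lt r b) E f t <-> fsat (constructible b) f (map_tuple pi t).
  move=> ba tb.
  have -> : constructible b = pi @` rank_lt r b.
    apply/seteqP; split=> [x bx|_ [d /ltP[//|_ bd] <-] //].
    by exists (h x); [exact: lth|apply: pih; apply: subL bx].
  apply: msat_iso => // i j /ltP[//|di _] /ltP[//|dj _] e.
  by rewrite -(hpi i) // e hpi.
have realP b q i : leV b a -> params_lt r b q ->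
    elts (pi i) = [set y | constructible b y /\
      fsat (constructible b) (projT2 q).1 [tuple of y :: map_tuple pi (projT2 q).2]] ->
    realises a E r b q i.
  move=> ba pq iE k /lta dk; rewrite /E -[_ ∈ _]/(elts (pi i) (pi k)) iE.
  split=> [[bk]|[kb]].
    have kb : rank_lt r b k by apply/ltP.
    rewrite -map_tuple_cons => /iso h'; split=> //; apply: h' => //.
    exact: forall_tnth_cons.
  rewrite iso //; last exact: forall_tnth_cons.
  by rewrite map_tuple_cons; case/(ltP _ _ ba): kb.
exists E, r, o; split; last first.
  move=> x xa; have ax := ordinal_sub_constructible oa xa; exists (h x).
  split; first by apply/lta; apply: domh.
  by have [o1 _] := oP (h x); rewrite o1 pih //; split=> //; apply: domh.
have ta := oa.1.
split=> /=.
- move=> i j /lta di /lta dj ij; rewrite -(hpi i) // -(hpi j) //; congr h.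
  apply: sets_ext => z; split=> zi.
    have az := constructible_trans ta (piL i di) zi.
    have /ij : rank_lt r a (h z) by apply/lta; apply: domh.
    by rewrite /E pih // => -[+ _]; apply.
  have az := constructible_trans ta (piL j dj) zi.
  have /ij : rank_lt r a (h z) by apply/lta; apply: domh.
  by rewrite /E pih // => -[_]; apply.
- move=> i /lta di; have [r1 _] := rP i; rewrite r1 //.
  have [ra [n [f [p [pL iE]]]] _] := rkP _ (piL i di).
  have ra' : leV (rk (pi i)) a by left.
  pose q : fo_inst mu := existT _ n (f, map_tuple h p).
  have pq : params_lt r (rk (pi i)) q by move=> l; rewrite tnth_map; apply: lth.
  exists q; split=> //; apply: realP => //.
  suff -> : map_tuple pi (projT2 q).2 = p by [].
  apply: eq_from_tnth => l; rewrite !tnth_map pih //; exact: subL (pL l).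
- move=> [b bla] /= ba [n [f p]] pq; have ba' : leV b a by left.
  (* The subset that [q] defines over level [b] is a set, because the level is small; its rank is at
     most [b] by minimality. *)
  set S := [set y | constructible b y /\
    fsat (constructible b) f [tuple of y :: map_tuple pi p]].
  have SE : elts (toV S) = S.
    apply: toVE; apply: small_sub (small_covered (covL b bla)).
    by move=> y [].
  have DS : Def (constructible b) (toV S).
    exists n, f, (map_tuple pi p); split=> // l; rewrite tnth_map.
    by have /(ltP _ _ ba')[] := pq l.
  have aS : constructible a (toV S) by apply: constructible_sub_Def DS.
  have dS := domh _ aS.
  exists (h (toV S)); split; last by apply: realP => //; rewrite pih.
  have [r1 _] := rP (h (toV S)); rewrite r1 // pih // => br.
  have [_ _ rmin] := rkP _ aS.
  have ob := ordinal_mem oa ba.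
  apply: (@memV_irr b); apply: memV_leV br _ => //; exact: rmin.
- move=> i _ /oltP[di pia oi]; rewrite oi; split=> [k /lta dk Eki|c ci].
    have [o1 _] := oP k; rewrite o1 //; split=> //; exact: ordinal_trans Eki.
  have ca : sval c ∈ a by apply: ordinal_trans ci.
  have ac := ordinal_sub_constructible oa ca.
  exists (h (sval c)); split; first by apply/lta; apply: domh.
  split; first by rewrite /E pih.
  apply: sval_inj; have [o1 _] := oP (h (sval c)); rewrite o1 ?pih //.
  by split=> //; apply: domh.
Qed.

End Code.

(** * Stationarity expressed in the infinitary logic *)

Section Definability.
Variables (mu la : V) (Hmu : infinite_cardinal mu) (Hla : successor_cardinal mu la).

Let D := idx mu.
Let ola : ordinal_set la := successor_ordinal Hla.

(** Points of the coded structure are fixed indices rather than variables: their equality is a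
    constant, and a quantifier over them becomes a disjunction over [idx]. *)
Lemma definable_msat X (M : D -> set V -> (X -> idx la) -> Prop)
    (E : D -> D -> set V -> (X -> idx la) -> Prop) n (f : fo n) t :
  (forall i, definable (M i)) -> (forall i j, definable (E i j)) ->
  definable (fun A e => msat (fun i => M i A e) (fun i j => E i j A e) f t).
Proof.
move=> dM dE; elim: f t => {n} [n i j|n i j|n g IH|n g IHg h IHh|n g IH] t /=.
- exact: (definable_const Hmu Hla).
- exact: dE.
- exact: definable_not.
- exact: (definable_and Hmu Hla).
- apply: (definable_exists Hla); first exact: index_small_idx.
  by move=> d; apply: (definable_and Hmu Hla).
Qed.

(** A relation on indices is coded by ordinals: a pair is related when its variable has the same
    value as the marker [z]. Points and formula instances are handled by conjunctions and
    disjunctions; only the ordinals [b] and [c] are quantified. *)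
Lemma definable_level_code X (a z : X) (ev : D * D -> X) (r o : D -> X) :
  definable (fun _ (e : X -> idx la) =>
    level_code (e a) (fun i j => e (ev (i, j)) = e z)
      (fun d => e (r d)) (fun d => e (o d))).
Proof.
have sD := index_small_idx mu.
have sK := index_small_inst Hmu.
have dlt := definable_lt; have deq := definable_eq.
have dpar Y (r' : D -> Y) b q :
    definable (fun _ (e : Y -> idx la) => params_lt (fun d => e (r' d)) (sval (e b)) q).
  apply: (definable_forall Hla) => [|l]; last exact: dlt.
  exact: (index_small_count Hmu).
have dreal Y (a' z' : Y) (ev' : D * D -> Y) (r' : D -> Y) b q i :
    definable (fun _ (e : Y -> idx la) => realises (sval (e a'))
      (fun i j => e (ev' (i, j)) = e z') (fun d => e (r' d)) (sval (e b)) q i).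
  apply: (definable_forall Hla sD) => k; apply: (definable_imp Hmu Hla);
    first exact: dlt.
  apply: (definable_iff Hmu Hla); first exact: deq.
  apply: (definable_and Hmu Hla); first exact: dlt.
  by apply: definable_msat => [d|d d']; [exact: dlt|exact: deq].
suff h : definable (fun _ (e : X -> idx la) =>
    let ra := rank_lt (fun d => e (r d)) (sval (e a)) in
    let E := fun i j : D => e (ev (i, j)) = e z in
    (forall i j, ra i -> ra j -> (forall k, ra k -> (E k i <-> E k j)) -> i = j) /\
    ((forall i, ra i -> exists q, params_lt (fun d => e (r d)) (sval (e (r i))) q /\
       realises (sval (e a)) E (fun d => e (r d)) (sval (e (r i))) q i) /\
    ((forall b : idx la, sval b ∈ sval (e a) -> forall q,
       params_lt (fun d => e (r d)) (sval b) q -> exists i,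
       ~ (sval b ∈ sval (e (r i))) /\
       realises (sval (e a)) E (fun d => e (r d)) (sval b) q i) /\
    (forall i, ra i -> sval (e (o i)) ∈ sval (e a) ->
       (forall k, ra k -> E k i -> sval (e (o k)) ∈ sval (e (o i))) /\
       (forall c : idx la, sval c ∈ sval (e (o i)) ->
          exists k, ra k /\ (E k i /\ e (o k) = c)))))).
  by apply: definable_ext h => A e; split=> [[? [? []]]|[]].
apply: (definable_and Hmu Hla);
  [|apply: (definable_and Hmu Hla); [|apply: (definable_and Hmu Hla)]].
- apply: (definable_forall Hla sD) => i; apply: (definable_forall Hla sD) => j;
    do 2 (apply: (definable_imp Hmu Hla); first exact: dlt).
  apply: (definable_imp Hmu Hla); last exact: (definable_const Hmu Hla).
  apply: (definable_forall Hla sD) => k; apply: (definable_imp Hmu Hla);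
    first exact: dlt.
  by apply: (definable_iff Hmu Hla); exact: deq.
- apply: (definable_forall Hla sD) => i; apply: (definable_imp Hmu Hla);
    first exact: dlt.
  apply: (definable_exists Hla) => // q; apply: (definable_and Hmu Hla);
    first exact: dpar.
  exact: dreal.
- apply: (definable_forall1 Hmu Hla); apply: (definable_imp Hmu Hla);
    first exact: dlt.
  apply: (definable_forall Hla) => // q; apply: (definable_imp Hmu Hla); first
    exact: (dpar _ (fun d => inl (r d)) (inr tt)).
  apply: (definable_exists Hla sD) => i; apply: (definable_and Hmu Hla).
    by apply: definable_not; exact: dlt.
  exact: (dreal _ (inl a) (inl z) (fun p => inl (ev p)) (fun d => inl (r d)) (inr tt)).
- apply: (definable_forall Hla sD) => i;
    do 2 (apply: (definable_imp Hmu Hla); first exact: dlt).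
  apply: (definable_and Hmu Hla).
    apply: (definable_forall Hla sD) => k; apply: (definable_imp Hmu Hla);
      first exact: dlt.
    by apply: (definable_imp Hmu Hla); [exact: deq|exact: dlt].
  apply: (definable_forall1 Hmu Hla); apply: (definable_imp Hmu Hla);
    first exact: dlt.
  apply: (definable_exists Hla sD) => k; apply: (definable_and Hmu Hla);
    first exact: dlt.
  by apply: (definable_and Hmu Hla); exact: deq.
Qed.

(* [coded_sat f x y] is "there is [a < la] with [x, y < a] and [L_a |= f(x, y)]". *)
Definition coded_sat (f : fo 2) (x : D) (y : idx la) : Prop :=
  exists a z : idx la, exists (ev : D * D -> idx la) (r o : D -> idx la),
    level_code a (fun i j => ev (i, j) = z) r o /\
    exists i j : D, (sval (r i) ∈ sval a /\ sval (r j) ∈ sval a) /\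
      ((sval (o i) = sval x /\ o j = y) /\
       (sval (o i) ∈ sval a /\ sval (o j) ∈ sval a)) /\
      msat (rank_lt r (sval a)) (fun i j => ev (i, j) = z) f [tuple i; j].

Lemma definable_coded_sat X f (x : D) (y : X) :
  definable (fun _ (e : X -> idx la) => coded_sat f x (e y)).
Proof.
have sD := index_small_idx mu; have sDD := index_small_pair Hmu.
have xla : sval x ∈ la by case: (Hla) => _ mula _; apply: ordinal_trans (svalP x).
do 2 apply: (definable_exists1 Hmu Hla).
do 3 (apply: (definable_exists_block Hla) => //).
apply: (definable_and Hmu Hla).
  (* The variables were bound in the order [a], [z], [ev], [r], [o]; each [inl] passes over one
     block bound later. *)
  exact: (definable_level_code
    (inl (inl (inl (inl (inr tt))))) (inl (inl (inl (inr tt))))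
    (fun p => inl (inl (inr p))) (fun d => inl (inr d)) (fun d => inr d)).
apply: (definable_exists Hla) => // i; apply: (definable_exists Hla) => // j.
apply: (definable_and Hmu Hla); first by apply: (definable_and Hmu Hla);
  exact: definable_lt.
apply: (definable_and Hmu Hla).
  apply: (definable_and Hmu Hla); last by apply: (definable_and Hmu Hla);
    exact: definable_lt.
  by apply: (definable_and Hmu Hla);
    [exact: (definable_ordinal Hmu Hla)|exact: definable_eq].
by apply: definable_msat => [d|d d']; [exact: definable_lt|exact: definable_eq].
Qed.

(** A code gives true satisfaction because it is isomorphic to the level; conversely every level
    below [la] has a code. *)
Lemma coded_satP f (x : D) (y : idx la) : coded_sat f x y <->
  exists a, [/\ a ∈ la, sval x ∈ a, sval y ∈ a &
    fsat (constructible a) f [tuple sval x; sval y]].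
Proof.
case: (Hla) => _ mula _; split.
  move=> [a [z [ev [r [o [code [i [j [[ia ja] [[[ox oy] [oi oj]] h]]]]]]]]]].
  exists (sval a); split; [exact: (svalP a)|by rewrite -ox|by rewrite -oy|].
  by rewrite -ox -oy; apply/(level_code_sat Hla f code).
move=> [a [ala xa ya h]]; pose a' : idx la := exist _ a ala.
have [E [r [o [code ocov]]]] := level_code_ex Hmu Hla a'.
have [i [ia oi]] := ocov _ xa; have [j [ja oj]] := ocov _ ya.
have xla : sval x ∈ la by apply: ordinal_trans (svalP x).
(* Two distinct ordinals suffice to code [E] by its characteristic function. *)
pose z0 : idx la := exist _ (sval x) xla; pose z1 : idx la := exist _ mu mula.
have z01 : z0 <> z1.
  by move=> /(congr1 sval) /= e; have := svalP x; rewrite e => /memV_irr.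
pose ev (p : D * D) := if pselect (E p.1 p.2) is left _ then z1 else z0.
have EE : (fun i j => ev (i, j) = z1) = E.
  apply/funext => k; apply/funext => l; apply/propext; rewrite /ev /=.
  by case: pselect.
exists a', z1, ev, r, o; rewrite EE; split=> //; exists i, j; split=> //.
have oj' : o j = y by apply: sval_inj.
split; first by rewrite oi oj'.
by apply/(level_code_sat Hla f code); rewrite /= ?oi ?oj.
Qed.

(* The set of [a < la] with [B_a \ X] bounded in [mu], for the [B] defined by [f]. *)
Definition coded_set (f : fo 2) (X : D -> Prop) (a : idx la) : Prop :=
  exists b : D, forall x : D, coded_sat f x a -> ~ X x -> leV (sval x) (sval b).

Lemma definable_coded_set X f (xs : D -> X) (z a : X) :
  definable (fun _ (e : X -> idx la) => coded_set f (fun d => e (xs d) = e z) (e a)).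
Proof.
have sD := index_small_idx mu.
apply: (definable_exists Hla) => // b; apply: (definable_forall Hla) => // x.
apply: (definable_imp Hmu Hla); first exact: definable_coded_sat.
apply: (definable_imp Hmu Hla); last exact: (definable_const Hmu Hla).
by apply: definable_not; exact: definable_eq.
Qed.

(** Being club, with limit ordinals unfolded so that only elements of [la] are quantified. *)
Definition club_in (C : idx la -> Prop) : Prop :=
  (forall b : idx la, exists c, C c /\ sval b ∈ sval c) /\
  (forall g : idx la, (exists b : idx la, sval b ∈ sval g) ->
     (forall b : idx la, sval b ∈ sval g ->
        exists c : idx la, sval c ∈ sval g /\ sval b ∈ sval c) ->
     (forall b : idx la, sval b ∈ sval g ->
        exists c : idx la, C c /\ (sval c ∈ sval g /\ sval b ∈ sval c)) -> C g).

(** The block [xs] and the marker [z] code an arbitrary subset of [mu]. *)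
Definition coded_stationary (f : fo 2) (A : set V) : Prop :=
  forall (z : idx la) (xs : D -> idx la),
    club_in (coded_set f (fun d => xs d = z)) ->
    exists a, A (sval a) /\ coded_set f (fun d => xs d = z) a.

Lemma definable_coded_stationary f :
  definable (fun A (_ : void -> idx la) => coded_stationary f A).
Proof.
apply: (definable_forall1 Hmu Hla); apply: (definable_forall_block Hla);
  first exact: index_small_idx.
have dlt := definable_lt; have dset := definable_coded_set.
apply: (definable_imp Hmu Hla).
  apply: (definable_and Hmu Hla).
    apply: (definable_forall1 Hmu Hla); apply: (definable_exists1 Hmu Hla);
      apply: (definable_and Hmu Hla); last exact: dlt.
    exact: (dset _ f (fun d => inl (inl (inr d))) (inl (inl (inl (inr tt)))) (inr tt)).
  apply: (definable_forall1 Hmu Hla); apply: (definable_imp Hmu Hla).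
    by apply: (definable_exists1 Hmu Hla); exact: dlt.
  apply: (definable_imp Hmu Hla).
    apply: (definable_forall1 Hmu Hla); apply: (definable_imp Hmu Hla);
      first exact: dlt.
    by apply: (definable_exists1 Hmu Hla); apply: (definable_and Hmu Hla);
      exact: dlt.
  apply: (definable_imp Hmu Hla).
    apply: (definable_forall1 Hmu Hla); apply: (definable_imp Hmu Hla);
      first exact: dlt.
    apply: (definable_exists1 Hmu Hla); apply: (definable_and Hmu Hla); last first.
      by apply: (definable_and Hmu Hla); exact: dlt.
    exact: (dset _ f (fun d => inl (inl (inl (inr d))))
      (inl (inl (inl (inl (inr tt))))) (inr tt)).
  exact: (dset _ f (fun d => inl (inr d)) (inl (inl (inr tt))) (inr tt)).
apply: (definable_exists1 Hmu Hla); apply: (definable_and Hmu Hla);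
  first exact: definable_in.
exact: (dset _ f (fun d => inl (inr d)) (inl (inl (inr tt))) (inr tt)).
Qed.

Lemma club_inP (C : set V) : C `<=` elts la ->
  club la C <-> club_in (fun a => C (sval a)).
Proof.
move=> Cla; split.
  move=> [_ unb cl]; split=> [[b bla]|[g gla] /= [b bg] lim unbg].
    by have [c [Cc cla bc]] := unb b bla; exists (exist _ c cla).
  have og := ordinal_mem ola gla.
  have gl c : c ∈ g -> c ∈ la by apply: ordinal_trans.
  apply: cl => //.
    split=> //; first by exists (sval b).
    by move=> c cg; have [d [dg cd]] := lim (exist _ c (gl c cg)) cg;
      exists (sval d).
  by move=> c cg; have [d [Cd [dg cd]]] := unbg (exist _ c (gl c cg)) cg;
    exists (sval d).
move=> [unb cl]; split=> // [b bla|g gla [_ [b bg] lim] unbg].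
  by have [c [Cc bc]] := unb (exist _ b bla); exists (sval c); split=> //;
    apply: (svalP c).
have gl c : c ∈ g -> c ∈ la by apply: ordinal_trans.
apply: (cl (exist _ g gla)) => /=.
- by exists (exist _ b (gl b bg)).
- by move=> [c cla] /= /lim[d dg cd]; exists (exist _ d (gl d dg)).
- by move=> [c cla] /= /unbg[d [Cd dg cd]]; exists (exist _ d (gl d dg)).
Qed.

(** Otherwise [delta] is at most [y] on a tail starting above [x] and [y], and the supremum of that
    tail is below [la]. *)
Lemma limsup_unbounded delta x y : (forall a, a ∈ la -> ordinal_set (delta a)) ->
  is_limsup la delta la -> x ∈ la -> y ∈ la ->
  exists a, [/\ a ∈ la, x ∈ a, y ∈ a & y ∈ delta a].
Proof.
move=> od [_ lims] xla yla.
have [b bla mb] := successor_limit Hmu Hla (maxV_mem xla yla).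
have ob := ordinal_mem ola bla.
have [xm ym] := maxV_le (ordinal_mem ola xla) (ordinal_mem ola yla).
apply: contrapT => none.
pose T := delta @` [set a | a ∈ la /\ leV b a].
have [||s sT] := @sup_ex T.
- by apply: small_image; apply: small_sub (small_elts la) => a [].
- by move=> _ [a [ala _] <-]; apply: od.
have := lims b s bla sT; case: sT => os _ smin las.
have sy : leV s y.
  apply: smin; first exact: ordinal_mem yla.
  move=> _ [a [ala ba] <-]; have oa := ordinal_mem ola ala.
  apply: ordinal_leVN; [exact: ordinal_mem yla|exact: od|] => yd.
  apply: none; exists a; split=> //.
    by apply: memV_leV ba => //; apply: leV_memV mb.
  by apply: memV_leV ba => //; apply: leV_memV mb.
apply: (@memV_irr la); apply: leV_memV las _ => //.
exact: leV_memV sy yla.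
Qed.

End Definability.

(** * Stationarity through codes of clubs *)

Unset Implicit Arguments.
Set Strict Implicit.

Theorem theorem10 (mu la : V) (Hmu : infinite_cardinal mu)
    (Hla : successor_cardinal mu la) (B : V -> set V)
    (HB : almost_disjoint_sequence mu la B) (HdefB : definable_on_L la B)
    (Hclub : forall C : set V, club la C ->
       exists2 X : set V, X `<=` elts mu &
         forall a, a ∈ la -> (C a <-> sup_lt (B a `\` X) mu)) :
  exists phi : Lsentence la, forall A : set V, A `<=` elts la ->
    (ordinal_models A phi <-> stationary la A).
Proof.
case: HdefB => delta [od lims [f fP] _].
have ola := successor_ordinal Hla; have omu : ordinal_set mu := Hmu.1.1.
have [_ mula _] := Hla.
have muP x : x ∈ mu -> x ∈ la by apply: ordinal_trans.
(* The restriction to [y ∈ delta a] disappears because some level [a] has [delta a] above [y]. *)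
have satB (x : idx mu) (y : idx la) : coded_sat f x y <-> B (sval y) (sval x).
  have xla := muP _ (svalP x); rewrite (coded_satP Hmu Hla); split.
    by move=> [a [ala xa ya /(fP a _ _ ala xa ya)[]]].
  move=> Byx;
    have [a [ala xa ya yd]] := limsup_unbounded Hmu Hla od lims xla (svalP y).
  by exists a; split=> //; apply/fP.
have setP X (a : idx la) :
    coded_set f (fun d : idx mu => X (sval d)) a <-> sup_lt (B (sval a) `\` X) mu.
  rewrite sup_lt_bounded //; last by move=> x [Bx _]; apply: (HB.1 _ (svalP a)).1.
  split=> [[b h]|[b bmu h]].
    exists (sval b); first exact: (svalP b).
    move=> x [Bx nX]; have xmu := (HB.1 _ (svalP a)).1 _ Bx.
    by apply: (h (exist _ x xmu)) => //; apply/satB.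
  by exists (exist _ b bmu) => x /satB Bx nX; apply: h.
have [phi phiP] := definable_coded_stationary Hmu Hla f.
exists phi => A Ala; rewrite /ordinal_models phiP; split.
  move=> st C clubC; have [X Xmu CX] := Hclub C clubC.
  have [x0 x0mu] := infinite_setN0 Hmu.2.
  (* The code [X] of the club is turned into a block of variables, as a characteristic function with
     values [z0] and [z1]. *)
  pose z0 : idx la := exist _ x0 (muP _ x0mu); pose z1 : idx la := exist _ mu mula.
  have z01 : z0 <> z1.
    by move=> /(congr1 sval) /= e; apply: (@memV_irr mu); rewrite -{1}e.
  pose xs (d : idx mu) := if pselect (X (sval d)) is left _ then z1 else z0.
  have xsE : (fun d => xs d = z1) = (fun d => X (sval d)).
    by apply: funext => d; apply: propext; rewrite /xs; case: pselect.
  have CE (a : idx la) : coded_set f (fun d => xs d = z1) a <-> C (sval a).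
    by rewrite xsE setP (CX _ (svalP a)).
  have CE' : coded_set f (fun d => xs d = z1) = (fun a : idx la => C (sval a)).
    by apply: funext => a; apply: propext; exact: CE.
  have := st z1 xs; rewrite CE' => -[|a [Aa Ca]]; last by exists (sval a).
  by apply/(club_inP Hla) => //; case: clubC.
move=> st z xs clubX.
(* Conversely, a coded set that satisfies [club_in] is a true club once read as a class of ordinals,
   so [A] meets it. *)
pose C := [set a | exists aa : idx la,
  sval aa = a /\ coded_set f (fun d => xs d = z) aa].
have CE : coded_set f (fun d => xs d = z) = (fun a : idx la => C (sval a)).
  apply: funext => a; apply: propext; split=> [h|[b [/sval_inj -> //]]].
  by exists a.
have Cla : C `<=` elts la by move=> _ [a [<- _]]; exact: (svalP a).
have [a [Aa [b [ba Cb]]]] : A `&` C !=set0.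
  by apply: st; apply/(club_inP Hla) => //; rewrite -CE.
by exists b; rewrite ba.
Qed.
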